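(* Let $s\ge2$. If $\tau$ has non-zero drift (i.e. $\mu(\tau)\ne0$) and satisfies exponential large deviation bounds, and $f$ and $G$ are exponentially mixing of order $s$, then $F$ is exponentially mixing of order $s$.
   Context: Setting. $X,Y$ are compact manifolds, $f:X\to X$ is a smooth map preserving a probability measure $\mu$, $(G_t)_{t\in\mathbb R^d}$ is a smooth $d$-parameter flow ($\mathbb R^d$-action) on $Y$ preserving a probability measure $\nu$, and $\tau:X\to\mathbb R^d$ is smooth. Put $\tau_N(x)=\sum_{n=0}^{N-1}\tau(f^nx)$, $\zeta=\mu\times\nu$, and $F(x,y)=(f(x),G_{\tau(x)}y)$ on $X\times Y$, so $F$ preserves $\zeta$. Write $\mu(A)=\int A\,d\mu$, etc. Mixing of order $s$. $G_t$ is mixing of order $s$ with rate $\psi$ on a space $\mathbb B$ if there is $C$ such that for all $B_1,\dots,B_s\in\mathbb B$ and all $t_1,\dots,t_s$, $$\left|\nu\Big(\prod_{j=1}^sB_j(G_{t_j}y)\Big)-\prod_{j=1}^s\nu(B_j)\right|\le C\psi(\delta(t_1,\dots,t_s))\prod_{j=1}^s\|B_j\|_{\mathbb B},\qquad\delta(t_1,\dots,t_s)=\min_{i\ne j}\|t_i-t_j\|.$$ The definition extends to maps (such as $f$ with $\mu$ and $F$ with $\zeta$), with times being nonnegative integers and iterates of the map in place of $G_{t_j}$. ''Exponentially mixing of order $s$'' means this holds with $\mathbb B=C^r$ for some $r>0$ and $\psi(u)=e^{-cu}$ for some $c>0$. Exponential large deviation bounds: for each $\varepsilon>0$ there exist $C$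 and $\delta>0$ such that for any $N\in\mathbb N$, $\mu\left(\left\|\tau_N/N-\mu(\tau)\right\|\ge\varepsilon\right)\le Ce^{-\delta N}$. *)

(* Defs.v *)
From HB Require Import structures.
From mathcomp Require Import all_boot all_order all_algebra.
From mathcomp Require Import all_classical all_reals all_analysis.

Set Implicit Arguments.
Unset Strict Implicit.
Unset Printing Implicit Defensive.

Import Order.TTheory GRing.Theory Num.Theory.
Import numFieldNormedType.Exports.

Local Open Scope classical_set_scope.
Local Open Scope ring_scope.

Section Differentiability.
Variable R : realType.

Definition partial n (i : 'I_n) (u : 'rV[R]_n -> R) : 'rV[R]_n -> R :=
  fun x => 'D_(delta_mx 0 i) u x.

Definition partials n (l : seq 'I_n) (u : 'rV[R]_n -> R) : 'rV[R]_n -> R :=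
  foldr (@partial n) u l.

(* [U] should be open: all partial derivatives of order at most [k] exist and
   are continuous on [U]. *)
Fixpoint Ck n (k : nat) (U : set 'rV[R]_n) (u : 'rV[R]_n -> R) : Prop :=
  (forall x, U x -> {for x, continuous u}) /\
  (if k is k'.+1 then
     forall i : 'I_n, (forall x, U x -> derivable u x (delta_mx 0 i)) /\
                      Ck k' U (partial i u)
   else True).

Definition smooth_on m n (U : set 'rV[R]_m) (g : 'rV[R]_m -> 'rV[R]_n) : Prop :=
  forall (j : 'I_n) (k : nat), Ck k U (fun x => g x 0 j).

Lemma Ck_continuous n k (U : set 'rV[R]_n) u x :
  Ck k U u -> U x -> {for x, continuous u}.
Proof. by case: k => [|k] [+ _] => /[apply]. Qed.

Lemma Ck_cst n k (U : set 'rV[R]_n) (a : R) : Ck k U (fun=> a).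
Proof.
elim: k a => [|k IH] a; split=> //; try by move=> x _; exact: cst_continuous.
move=> i; split; first by move=> x _; apply: derivable_cst.
have -> : partial i (fun=> a) = fun=> 0; last exact: IH.
by apply/funext => x; rewrite /partial; exact: derive_cst.
Qed.

Lemma smooth_id n (U : set 'rV[R]_n) : smooth_on U id.
Proof.
move=> j k.
have cont (x : 'rV[R]_n) : {for x, continuous (fun x : 'rV[R]_n => x 0 j : R)}.
  exact: coord_continuous.
have dif x i : is_derive x (delta_mx 0 i) (fun x : 'rV[R]_n => x 0 j : R)
                 ((delta_mx 0 i : 'rV[R]_n) 0 j).
  have df := @differentiable_coord R 1 n x 0 j.
  apply: DeriveDef; first exact: diff_derivable.
  rewrite /derive; apply: cvg_lim => //; apply: cvg_near_cst.
  near=> h; rewrite /= !mxE addrK /GRing.scale/= mulrA mulVf ?mul1r//.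
  by near: h; exact: nbhs_dnbhs_neq.
case: k => [|k]; split=> //.
move=> i; split; first by move=> x _; have [] := dif x i.
have -> : partial i (fun x : 'rV[R]_n => x 0 j : R) =
      fun=> (delta_mx 0 i : 'rV[R]_n) 0 j.
  by apply/funext => x; rewrite /partial; have [] := dif x i.
exact: Ck_cst.
Unshelve. all: by end_near. Qed.

Lemma lsubmxDZ m n (h : R) (v x : 'rV[R]_(m + n)) :
  lsubmx (h *: v + x) = h *: lsubmx v + lsubmx x.
Proof. by apply/rowP => j; rewrite !mxE. Qed.

Lemma rsubmxDZ m n (h : R) (v x : 'rV[R]_(m + n)) :
  rsubmx (h *: v + x) = h *: rsubmx v + rsubmx x.
Proof. by apply/rowP => j; rewrite !mxE. Qed.

Lemma Ck_lsubmx m n k (U : set 'rV[R]_m) (u : 'rV[R]_m -> R) :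
  Ck k U u ->
  Ck k ((lsubmx : 'rV[R]_(m + n) -> _) @^-1` U) (fun w : 'rV[R]_(m + n) => u (lsubmx w)).
Proof.
elim: k u => [|k IH] u [uc du]; split => //; do ?
  by move=> x Ux; apply: continuous_comp; [exact: continuous_lsubmx|exact: uc].
move=> i; rewrite -(splitK i); case: (fintype.split i) => {}i /=.
- have E : (lsubmx (delta_mx 0 (lshift n i)) : 'rV[R]_m) = delta_mx 0 i.
    by apply/rowP => j; rewrite !mxE (inj_eq (@lshift_inj _ _)).
  have Q x : (fun h : R => h^-1 *: ((u \o lsubmx) (h *: delta_mx 0 (lshift n i) + x)
                 - (u \o lsubmx) x)) =
             (fun h : R => h^-1 *: (u (h *: delta_mx 0 i + lsubmx x)
                 - u (lsubmx x))).
    by apply/funext => h; rewrite /= lsubmxDZ E.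
  split=> [x Ux|].
    by rewrite /derivable /= (Q x); exact: (du i).1.
  have -> : partial (lshift n i) (u \o lsubmx) = partial i u \o lsubmx.
    by apply/funext => x; rewrite /partial /derive (Q x).
  exact/IH/(du i).2.
- have E : (lsubmx (delta_mx 0 (rshift m i)) : 'rV[R]_m) = 0.
    by apply/rowP => j; rewrite !mxE /= eq_lrshift ?andbF.
  have Q x : is_derive x (delta_mx 0 (rshift m i))
                (u \o (lsubmx : 'rV[R]_(m + n) -> _)) 0.
    have QE : (fun h : R => h^-1 *: ((u \o (lsubmx : 'rV[R]_(m + n) -> _))
           (h *: delta_mx 0 (rshift m i) + x) - (u \o lsubmx) x)) = fun=> 0.
      by apply/funext => h; rewrite /= lsubmxDZ E scaler0 add0r subrr scaler0.
    apply: DeriveDef; first by rewrite /derivable QE; exact: is_cvg_cst.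
    by rewrite /derive QE; exact: lim_cst.
  split=> [x Ux|]; first by have [] := Q x.
  have -> : partial (rshift m i) (u \o lsubmx) = fun=> 0.
    by apply/funext => x; rewrite /partial; have [] := Q x.
  exact: Ck_cst.
Qed.

Lemma Ck_rsubmx m n k (U : set 'rV[R]_n) (u : 'rV[R]_n -> R) :
  Ck k U u ->
  Ck k ((rsubmx : 'rV[R]_(m + n) -> _) @^-1` U) (fun w : 'rV[R]_(m + n) => u (rsubmx w)).
Proof.
elim: k u => [|k IH] u [uc du]; split => //; do ?
  by move=> x Ux; apply: continuous_comp; [exact: continuous_rsubmx|exact: uc].
move=> i; rewrite -(splitK i); case: (fintype.split i) => {}i /=.
- have E : (rsubmx (delta_mx 0 (lshift n i)) : 'rV[R]_n) = 0.
    by apply/rowP => j; rewrite !mxE /= eq_rlshift ?andbF.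
  have Q x : is_derive x (delta_mx 0 (lshift n i))
                (u \o (rsubmx : 'rV[R]_(m + n) -> _)) 0.
    have QE : (fun h : R => h^-1 *: ((u \o (rsubmx : 'rV[R]_(m + n) -> _))
           (h *: delta_mx 0 (lshift n i) + x) - (u \o rsubmx) x)) = fun=> 0.
      by apply/funext => h; rewrite /= rsubmxDZ E scaler0 add0r subrr scaler0.
    apply: DeriveDef; first by rewrite /derivable QE; exact: is_cvg_cst.
    by rewrite /derive QE; exact: lim_cst.
  split=> [x Ux|]; first by have [] := Q x.
  have -> : partial (lshift n i) (u \o rsubmx) = fun=> 0.
    by apply/funext => x; rewrite /partial; have [] := Q x.
  exact: Ck_cst.
- have E : (rsubmx (delta_mx 0 (rshift m i)) : 'rV[R]_n) = delta_mx 0 i.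
    by apply/rowP => j; rewrite !mxE (inj_eq (@rshift_inj _ _)).
  have Q x : (fun h : R => h^-1 *: ((u \o rsubmx) (h *: delta_mx 0 (rshift m i) + x)
                 - (u \o rsubmx) x)) =
             (fun h : R => h^-1 *: (u (h *: delta_mx 0 i + rsubmx x)
                 - u (rsubmx x))).
    by apply/funext => h; rewrite /= rsubmxDZ E.
  split=> [x Ux|].
    by rewrite /derivable /= (Q x); exact: (du i).1.
  have -> : partial (rshift m i) (u \o rsubmx) = partial i u \o rsubmx.
    by apply/funext => x; rewrite /partial /derive (Q x).
  exact/IH/(du i).2.
Qed.

Lemma Ck_subset n k (U V : set 'rV[R]_n) u : V `<=` U -> Ck k U u -> Ck k V u.
Proof.
move=> VU; elim: k u => [|k IH] u [uc du]; split => //; do ?by move=> x /VU/uc.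
by move=> i; split; [move=> x /VU/(du i).1|exact/IH/(du i).2].
Qed.

Lemma smooth_row_mx m n p q (U : set 'rV[R]_m) (V : set 'rV[R]_n)
    (g : 'rV[R]_m -> 'rV[R]_p) (h : 'rV[R]_n -> 'rV[R]_q) :
  smooth_on U g -> smooth_on V h ->
  smooth_on [set w : 'rV[R]_(m + n) | U (lsubmx w) /\ V (rsubmx w)]
            (fun w => row_mx (g (lsubmx w)) (h (rsubmx w))).
Proof.
move=> gs hs j k; rewrite -(splitK j); case: (fintype.split j) => {}j /=.
- rewrite [X in Ck _ _ X](_ : _ = fun w => g (lsubmx w) 0 j); last first.
    by apply/funext => w; rewrite row_mxEl.
  by apply: Ck_subset (@Ck_lsubmx _ n _ _ _ (gs j k)) => w [].
- rewrite [X in Ck _ _ X](_ : _ = fun w => h (rsubmx w) 0 j); last first.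
    by apply/funext => w; rewrite row_mxEr.
  by apply: Ck_subset (@Ck_rsubmx m _ _ _ _ (hs j k)) => w [].
Qed.

End Differentiability.

Section Manifolds.
Variable R : realType.

(* A homeomorphism [fwd], with inverse [bwd], of the open set [dom] of [X] onto
   the open set [img] of R^n; both functions are irrelevant elsewhere. *)
Record chart (n : nat) (X : topologicalType) := Chart {
  dom : set X;
  img : set 'rV[R]_n;
  fwd : X -> 'rV[R]_n;
  bwd : 'rV[R]_n -> X;
  open_dom : open dom;
  open_img : open img;
  fwd_img : forall x, dom x -> img (fwd x);
  bwd_dom : forall u, img u -> dom (bwd u);
  fwdK : forall x, dom x -> bwd (fwd x) = x;
  bwdK : forall u, img u -> fwd (bwd u) = u;
  fwd_continuous : forall x, dom x -> {for x, continuous fwd};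
  bwd_continuous : forall u, img u -> {for u, continuous bwd}
}.

Record manifold (n : nat) (X : topologicalType) := Manifold {
  atlas : Type;
  chart_of :> atlas -> chart n X;
  atlas_cover : forall x, exists c, dom (chart_of c) x;
  atlas_smooth : forall c c' : atlas,
    smooth_on [set u | img (chart_of c) u /\
                       dom (chart_of c') (bwd (chart_of c) u)]
              (fun u => fwd (chart_of c') (bwd (chart_of c) u))
}.

Definition smooth_map m n (X Y : topologicalType)
    (M : manifold m X) (N : manifold n Y) (f : X -> Y) : Prop :=
  continuous f /\
  forall (c : atlas M) (c' : atlas N),
    smooth_on [set u | img (M c) u /\ dom (N c') (f (bwd (M c) u))]
              (fun u => fwd (N c') (f (bwd (M c) u))).

Section Euclidean.
Variable n : nat.

Lemma id_continuous_at (u : 'rV[R]_n) : setT u -> {for u, continuous id}.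
Proof. by move=> _; exact: cvg_id. Qed.

Definition id_chart : chart n 'rV[R]_n :=
  @Chart n 'rV[R]_n setT setT id id openT openT (fun _ _ => I) (fun _ _ => I)
    (fun _ _ => erefl) (fun _ _ => erefl) id_continuous_at id_continuous_at.

Lemma euclidean_cover (x : 'rV[R]_n) : exists c : unit, dom id_chart x.
Proof. by exists tt. Qed.

Definition euclidean : manifold n 'rV[R]_n :=
  @Manifold n 'rV[R]_n unit (fun=> id_chart) euclidean_cover
    (fun _ _ => @smooth_id R n _).
End Euclidean.

Section Product.
Variables (m n : nat) (X Y : topologicalType).

Section ProductChart.
Variables (a : chart m X) (b : chart n Y).

Let pdom : set (X * Y) := dom a `*` dom b.
Let pimg : set 'rV[R]_(m + n) := [set w | img a (lsubmx w) /\ img b (rsubmx w)].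
Let pfwd (p : X * Y) : 'rV[R]_(m + n) := row_mx (fwd a p.1) (fwd b p.2).
Let pbwd (w : 'rV[R]_(m + n)) : X * Y := (bwd a (lsubmx w), bwd b (rsubmx w)).

Lemma prod_open_dom : open pdom.
Proof.
rewrite openE => -[x y] [/= ax bY]; exists (dom a, dom b) => //.
by split; apply: open_nbhs_nbhs; split => //; exact: open_dom.
Qed.

Lemma prod_open_img : open pimg.
Proof.
by apply: openI; [move/continuousP: (@continuous_lsubmx R 1 m n)
  |move/continuousP: (@continuous_rsubmx R 1 m n)]; apply; exact: open_img.
Qed.

Lemma prod_fwd_img p : pdom p -> pimg (pfwd p).
Proof.
by move=> [? ?]; rewrite /pimg/= row_mxKl row_mxKr; split; exact: fwd_img.
Qed.

Lemma prod_bwd_dom w : pimg w -> pdom (pbwd w).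
Proof. by move=> [? ?]; split; exact: bwd_dom. Qed.

Lemma prod_fwdK p : pdom p -> pbwd (pfwd p) = p.
Proof.
by case: p => x y [? ?]; rewrite /pbwd row_mxKl row_mxKr !fwdK.
Qed.

Lemma prod_bwdK w : pimg w -> pfwd (pbwd w) = w.
Proof. by move=> [? ?]; rewrite /pfwd !bwdK// hsubmxK. Qed.

Lemma prod_fwd_continuous p : pdom p -> {for p, continuous pfwd}.
Proof.
case: p => x y [/= ax bY]; apply/cvgrPdist_lt => e e0.
have /cvgrPdist_lt/(_ e e0) ha := fwd_continuous ax.
have /cvgrPdist_lt/(_ e e0) hb := fwd_continuous bY.
exists ([set x' | `|fwd a x - fwd a x'| < e], [set y' | `|fwd b y - fwd b y'| < e]) => //.
move=> [x' y'] [/= hx hy].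
rewrite /pfwd /= opp_row_mx add_row_mx.
move: hx hy; rewrite /Num.norm/= !mx_normrE => hx hy.
apply: bigmax_lt => //= -[i j] _ /=; rewrite (ord1 i).
rewrite -(splitK j); case: (fintype.split j) => {}j /=.
- rewrite row_mxEl; apply: le_lt_trans hx.
  exact: (@le_bigmax _ _ _ 0 (fun ij : 'I_1 * 'I_m =>
    `|(fwd a x - fwd a x') ij.1 ij.2|) (0, j)).
- rewrite row_mxEr; apply: le_lt_trans hy.
  exact: (@le_bigmax _ _ _ 0 (fun ij : 'I_1 * 'I_n =>
    `|(fwd b y - fwd b y') ij.1 ij.2|) (0, j)).
Qed.

Lemma prod_bwd_continuous w : pimg w -> {for w, continuous pbwd}.
Proof.
move=> [aw bw].
have ca : {for w, continuous (bwd a \o (lsubmx : 'rV[R]_(m + n) -> _))}.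
  by apply: continuous_comp; [exact: continuous_lsubmx|exact: bwd_continuous].
have cb : {for w, continuous (bwd b \o (rsubmx : 'rV[R]_(m + n) -> _))}.
  by apply: continuous_comp; [exact: continuous_rsubmx|exact: bwd_continuous].
exact: (cvg_pair ca cb).
Qed.

Definition prod_chart : chart (m + n) (X * Y)%type :=
  Chart prod_open_dom prod_open_img prod_fwd_img prod_bwd_dom prod_fwdK
    prod_bwdK prod_fwd_continuous prod_bwd_continuous.

End ProductChart.

Variables (M : manifold m X) (N : manifold n Y).

Lemma prod_cover (p : X * Y) :
  exists c : atlas M * atlas N, dom (prod_chart (M c.1) (N c.2)) p.
Proof.
have [c cx] := atlas_cover M p.1; have [c' cy] := atlas_cover N p.2.
by exists (c, c').
Qed.

Lemma prod_smooth (c c' : atlas M * atlas N) :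
  smooth_on
    [set w | img (prod_chart (M c.1) (N c.2)) w /\
             dom (prod_chart (M c'.1) (N c'.2))
                 (bwd (prod_chart (M c.1) (N c.2)) w)]
    (fun w => fwd (prod_chart (M c'.1) (N c'.2))
                  (bwd (prod_chart (M c.1) (N c.2)) w)).
Proof.
have := smooth_row_mx (@atlas_smooth _ _ M c.1 c'.1) (@atlas_smooth _ _ N c.2 c'.2).
by move=> h j k; apply: Ck_subset (h j k) => w [[? ?] [? ?]].
Qed.

Definition prod_manifold : manifold (m + n) (X * Y)%type :=
  Manifold prod_cover prod_smooth.

End Product.

Definition box n (lo hi : 'rV[R]_n) : set 'rV[R]_n :=
  [set u | forall j, lo 0 j <= u 0 j <= hi 0 j].

(* For X compact, every choice of a finite cover of X by compact coordinate
   boxes gives a norm on C^r(X); different choices give equivalent norms. *)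
Record box_cover n (X : topologicalType) (M : manifold n X) := BoxCover {
  bix : finType;
  bchart : bix -> atlas M;
  blo : bix -> 'rV[R]_n;
  bhi : bix -> 'rV[R]_n;
  box_img : forall i, box (blo i) (bhi i) `<=` img (M (bchart i));
  box_covers : forall x, exists i,
    (bwd (M (bchart i)) @` box (blo i) (bhi i)) x
}.

Lemma box_ballP n (x u : 'rV[R]_n) (e : R) : 0 <= e ->
  box (x - const_mx e) (x + const_mx e) u <-> `|x - u| <= e.
Proof.
move=> e0; rewrite /Num.norm/= mx_normrE; split=> [h|/bigmax_leP[_ h] j].
  apply: bigmax_le => // -[i j] _ /=; rewrite (ord1 i) !mxE.
  by have := h j; rewrite !mxE ler_distlC.
by have := h (0, j) isT; rewrite /= !mxE ler_distlC.
Qed.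

Lemma compact_box_cover n (X : ptopologicalType) (M : manifold n X) :
  compact [set: X] -> inhabited (box_cover M).
Proof.
move=> cX.
have [c cP] : {c : X -> atlas M & forall x, dom (M (c x)) x}.
  by apply: (@choice _ _ (fun x c => dom (M c) x)) => x; exact: atlas_cover.
have /choice[e eP] x : exists e : R, 0 < e /\
    forall u, `|fwd (M (c x)) x - u| <= e -> img (M (c x)) u.
  have := @open_img _ _ (M (c x)); rewrite openE => /(_ _ (fwd_img (cP x))).
  move=> /nbhs_ballP[e /= e0 eP]; exists (e / 2); split; first exact: divr_gt0.
  move=> u ue; apply: eP; rewrite -ball_normE /=; apply: le_lt_trans ue _.
  by rewrite ltr_pdivrMr// ltr_pMr// ltr1n.
pose V x := (dom (M (c x)) `&`
  [set y | `|fwd (M (c x)) x - fwd (M (c x)) y| <= e x])°.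
have VP x : V x x.
  rewrite /V interiorI; split.
    by have := @open_dom _ _ (M (c x)); rewrite openE => /(_ _ (cP x)).
  have /cvgrPdist_le := fwd_continuous (cP x).
  by apply; have [] := eP x.
move: cX; rewrite compact_cover => /(_ _ setT V).
case=> [x _|x _|D _ DV]; first exact: open_interior.
  by exists x.
apply: inhabits.
pose s : seq X := finmap.enum_fset D.
pose x_ (i : 'I_(size s)) := nth point s i.
apply: (@BoxCover n X M 'I_(size s) (fun i => c (x_ i))
  (fun i => fwd (M (c (x_ i))) (x_ i) - const_mx (e (x_ i)))
  (fun i => fwd (M (c (x_ i))) (x_ i) + const_mx (e (x_ i)))).
  move=> i u /box_ballP; have [/ltW e0 h] := eP (x_ i).
  by move=> /(_ e0)/h.
move=> y; have [x /= xD /interior_subset[/= dy ey]] := DV y I.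
have iD : (index x s < size s)%N by rewrite index_mem.
exists (Ordinal iD); rewrite /x_ /= nth_index//.
exists (fwd (M (c x)) y); last exact: fwdK.
by apply/box_ballP => //; have [/ltW] := eP x.
Qed.

Section ProductCover.
Variables (m n : nat) (X Y : topologicalType).
Variables (M : manifold m X) (N : manifold n Y).
Variables (D : box_cover M) (E : box_cover N).

Let pchart (i : bix D * bix E) : atlas (prod_manifold M N) :=
  (bchart i.1, bchart i.2).
Let plo (i : bix D * bix E) := row_mx (blo i.1) (blo i.2).
Let phi (i : bix D * bix E) := row_mx (bhi i.1) (bhi i.2).

Lemma box_row_mx (lo hi : 'rV[R]_m) (lo' hi' : 'rV[R]_n) w :
  box (row_mx lo lo') (row_mx hi hi') w <->
  box lo hi (lsubmx w) /\ box lo' hi' (rsubmx w).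
Proof.
split=> [h|[h h'] j].
  split=> j; [have := h (lshift n j)|have := h (rshift m j)];
    by rewrite ?row_mxEl ?row_mxEr mxE.
rewrite -(splitK j); case: (fintype.split j) => {}j /=.
  by have := h j; rewrite !row_mxEl mxE.
by have := h' j; rewrite !row_mxEr mxE.
Qed.

Lemma prod_box_img i : box (plo i) (phi i) `<=` img (prod_manifold M N (pchart i)).
Proof. by move=> w /box_row_mx[? ?]; split; exact: box_img. Qed.

Lemma prod_box_covers p : exists i,
  (bwd (prod_manifold M N (pchart i)) @` box (plo i) (phi i)) p.
Proof.
have [i [u ui ux]] := box_covers D p.1; have [j [v vj vy]] := box_covers E p.2.
exists (i, j), (row_mx u v); first by apply/box_row_mx; rewrite row_mxKl row_mxKr.
by rewrite /= row_mxKl row_mxKr [p]surjective_pairing -ux -vy.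
Qed.

Definition prod_box_cover : box_cover (prod_manifold M N) :=
  BoxCover prod_box_img prod_box_covers.
End ProductCover.

End Manifolds.

Section FunctionSpaces.
Variable R : realType.

Record fspace (T : Type) := FSpace {
  fs_mem : set (T -> R);
  fs_norm : (T -> R) -> R
}.

Section Cr.
Variables (n : nat) (X : topologicalType) (M : manifold R n X).
Variable D : box_cover M.

(* r = k + a with k a natural number and 0 <= a < 1; C^r is the space of C^k
   functions whose derivatives of order k are a-Hoelder if a > 0. *)
Definition Cr_enorm (r : R) (B : X -> R) : \bar R :=
  let k := Num.truncn r in
  let a := r - k%:R in
  let d l i := partials l (B \o bwd (M (bchart i))) in
  let K (i : bix D) := box (blo i) (bhi i) in
  ereal_sup
    ([set e | exists i l u, [/\ K i u, (size l <= k)%N & e = `|d l i u|%:E]]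
     `|`
     [set e | exists i l u v, [/\ K i u, K i v, u != v, size l = k & 0 < a /\
                e = (`|d l i u - d l i v| / `|u - v| `^ a)%:E]]).

Definition Cr (r : R) : fspace X := FSpace
  [set B : X -> R | (forall c, Ck (Num.truncn r) (img (M c)) (B \o bwd (M c))) /\
           (Cr_enorm r B < +oo)%E]
  (fun B => fine (Cr_enorm r B)).

End Cr.
End FunctionSpaces.

Definition borel (X : ptopologicalType) : measurableType _ :=
  g_sigma_algebraType (@open X).

Section Mixing.
Variable R : realType.

Definition min_gap (Theta : Type) (dist : Theta -> Theta -> R) (s : nat)
    (t : 'I_s -> Theta) : R :=
  inf [set g | exists i j, i != j /\ g = dist (t i) (t j)].

Definition mixing (d : measure_display) (T : measurableType d)
    (P : {measure set T -> \bar R}) (Theta : Type) (dist : Theta -> Theta -> R)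
    (act : Theta -> T -> T) (s : nat) (BB : fspace R T) (psi : R -> R) : Prop :=
  exists C : R, forall (B : 'I_s -> T -> R) (t : 'I_s -> Theta),
    (forall j, fs_mem BB (B j)) ->
    `| (\int[P]_y (\prod_j B j (act (t j) y))) - \prod_j (\int[P]_y B j y) |
      <= C * psi (min_gap dist t) * \prod_j fs_norm BB (B j).

(* [Crs r] stands for the space C^r. *)
Definition exp_mixing (d : measure_display) (T : measurableType d)
    (P : {measure set T -> \bar R}) (Theta : Type) (dist : Theta -> Theta -> R)
    (act : Theta -> T -> T) (s : nat) (Crs : R -> fspace R T) : Prop :=
  exists r c : R, [/\ 0 < r, 0 < c &
    mixing P dist act s (Crs r) (fun u => expR (- c * u))].

(* [`|.|] is the sup norm on R^q; another norm would only change the rate [c]. *)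
Definition exp_mixing_flow (d : measure_display) (T : measurableType d)
    (P : {measure set T -> \bar R}) (q : nat) (G : 'rV[R]_q -> T -> T) :=
  exp_mixing P (fun t t' => `|t - t'|) G.

Definition exp_mixing_map (d : measure_display) (T : measurableType d)
    (P : {measure set T -> \bar R}) (f : T -> T) :=
  exp_mixing P (fun k l : nat => `|k%:R - l%:R| : R) (fun k => iter k f).

Definition preserves (d : measure_display) (T : measurableType d)
    (P : {measure set T -> \bar R}) (f : T -> T) : Prop :=
  forall A, measurable A -> P (f @^-1` A) = P A.

Section Cocycle.
Variables (d : measure_display) (T : measurableType d).
Variables (P : {measure set T -> \bar R}) (f : T -> T).
Variables (q : nat) (tau : T -> 'rV[R]_q).

Definition mean : 'rV[R]_q := \row_j (\int[P]_x tau x 0 j).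

Definition ergodic_sum (N : nat) (x : T) : 'rV[R]_q :=
  \sum_(k < N) tau (iter k f x).

Definition exp_large_deviations : Prop :=
  forall eps : R, 0 < eps -> exists C delta : R, 0 < delta /\
    forall N : nat, (0 < N)%N ->
      (P [set x | (eps <= `|N%:R^-1 *: ergodic_sum N x - mean|)%R]
        <= (C * expR (- delta * N%:R))%:E)%E.

End Cocycle.
End Mixing.

Definition is_flow (R : realType) (q : nat) (Y : Type) (G : 'rV[R]_q -> Y -> Y) :=
  (forall y, G 0 y = y) /\ (forall t t' y, G (t + t') y = G t (G t' y)).

Definition skew_product (X Y V : Type) (f : X -> X) (G : V -> Y -> Y) (tau : X -> V)
  (p : X * Y) : X * Y := (f p.1, G (tau p.1) p.2).

(* Main.v *)
(** Fix [x] and integrate over [y] first.  Mixing of [G] at the times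
    [tau_{t_j}(x)] replaces the product of the fibre functions
    [B_j(f^{t_j} x, .)] by the product of their averages [b_j(f^{t_j} x)], with
    an error exponentially small in the smallest gap between these times.
    Since [tau_{t_j}(x) - tau_{t_i}(x)] is the ergodic sum of length [t_j - t_i]
    at [f^{t_i} x], large deviations and the non-zero drift make this gap at
    least a constant times the smallest gap between the [t_j], except on a set
    of exponentially small measure, where the trivial bound is enough.  Mixing
    of [f], applied to the averages [b_j], finishes.  The exponent for [F] is an
    integer exceeding both given exponents, so that bounds on derivatives
    control the Hoelder seminorms on the factors. *)
Require Import Defs.
From HB Require Import structures.
From mathcomp Require Import all_boot all_order all_algebra.
From mathcomp Require Import all_classical all_reals all_analysis.
From mathcomp Require Import measurable_realfun.
From mathcomp Require Import ring lra.
Set Implicit Arguments.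
Unset Strict Implicit.
Unset Printing Implicit Defensive.
Import Order.TTheory GRing.Theory Num.Theory.
Import numFieldNormedType.Exports.
Local Open Scope classical_set_scope.
Local Open Scope ring_scope.

(** * Partial derivatives and the mean value theorem *)

Section Calculus.
Variable R : realType.

Lemma Ck_partials n k (U : set 'rV[R]_n) u (l : seq 'I_n) :
  Ck k U u -> (size l <= k)%N -> Ck (k - size l) U (partials l u).
Proof.
elim: l => [|i l IH] /= uk; first by rewrite subn0.
move=> lk; have {IH} := IH uk (ltnW lk); rewrite subnS.
by case: (k - size l)%N (subn_gt0 (size l) k) => [|j] /=; [rewrite lk|move=> _ [_ /(_ i)[]]].
Qed.

Lemma Ck_continuous_partials n k (U : set 'rV[R]_n) u (l : seq 'I_n) x :
  Ck k U u -> (size l <= k)%N -> U x -> {for x, continuous (partials l u)}.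
Proof. by move=> uk lk; apply: Ck_continuous (Ck_partials uk lk). Qed.

Lemma Ck_derivable_partials n k (U : set 'rV[R]_n) u (l : seq 'I_n) i x :
  Ck k U u -> (size l < k)%N -> U x ->
  derivable (partials l u) x (delta_mx 0 i).
Proof.
move=> uk lk Ux; have := Ck_partials uk (ltnW lk).
case: (k - size l)%N (subn_gt0 (size l) k) => [|j] /=; first by rewrite lk.
by move=> _ [_ /(_ i)[/(_ x Ux)]].
Qed.

(** [Ck] differentiates from the inside, whereas the head of the list in [partials] is the outermost
    derivative; so the induction on [k] appends the new index at the end of the list. *)
Lemma CkP n k (U : set 'rV[R]_n) u :
  (forall l x, (size l <= k)%N -> U x -> {for x, continuous (partials l u)}) ->
  (forall l i x, (size l < k)%N -> U x ->
     derivable (partials l u) x (delta_mx 0 i)) ->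
  Ck k U u.
Proof.
elim: k u => [|k IH] u uc ud; split=> //; try by move=> x; apply: (uc [::]).
move=> i; split=> [x Ux|]; first exact: (ud [::]).
by apply: IH => [l x lk|l j x lk];
  [have := uc (rcons l i) x|have := ud (rcons l i) j x];
  rewrite size_rcons /partials foldr_rcons; apply.
Qed.

(** Reduces to the one-variable mean value theorem for [t |-> u (t e + x)], whose difference
    quotients are those of [u] along [e]. The disjunction on [t] allows [h] of either sign. *)
Lemma mvt_partial n (u : 'rV[R]_n -> R) i x (h : R) :
  (forall t, (0 <= t <= h) || (h <= t <= 0) ->
     derivable u (t *: delta_mx 0 i + x) (delta_mx 0 i)) ->
  exists2 t, (0 <= t <= h) || (h <= t <= 0) &
    u (h *: delta_mx 0 i + x) - u x =
      h * partial i u (t *: delta_mx 0 i + x).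
Proof.
move=> du; set e := delta_mx 0 i in du *.
pose g t := u (t *: e + x).
have E t : (fun s : R => s^-1 *: (g (s *: 1 + t) - g t)) =
           (fun s : R => s^-1 *: (u (s *: e + (t *: e + x)) - u (t *: e + x))).
  by apply/funext => s; rewrite /g scalerDl addrA /GRing.scale /= mulr1.
pose seg t := (0 <= t <= h) || (h <= t <= 0).
have dg (t : R) : seg t -> is_derive t 1 g (partial i u (t *: e + x)).
  move=> th; apply: DeriveDef.
    by rewrite /derivable (E t); exact: du.
  by rewrite /derive (E t).
have gc (a b : R) : (forall t, t \in `[a, b] -> seg t) ->
    {within `[a, b], continuous g}.
  move=> ab; apply: derivable_within_continuous => t /ab/dg dgt.
  exact: ex_derive.
have g0 : g 0 = u x by rewrite /g scale0r add0r.
rewrite -/(g h) -g0.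
have [h0|/ltW h0] := leP 0 h.
- have ah t : t \in `[0, h] -> seg t by rewrite in_itv /seg /= => ->.
  have [t tI ->] := MVT_segment h0 (fun t tI => dg t (ah t (subset_itv_oo_cc tI))) (gc _ _ ah).
  by exists t; [exact: ah|rewrite subr0 mulrC].
- have ah t : t \in `[h, 0] -> seg t by rewrite in_itv /seg /= orbC => ->.
  have [t tI] := MVT_segment h0 (fun t tI => dg t (ah t (subset_itv_oo_cc tI))) (gc _ _ ah).
  rewrite sub0r => gE; exists t; first exact: ah.
  by rewrite -opprB gE mulrN opprK mulrC.
Qed.

Lemma box_lipschitz n (lo hi : 'rV[R]_n) (g : 'rV[R]_n -> R) (N : R) :
  0 <= N ->
  (forall i x, box lo hi x -> derivable g x (delta_mx 0 i)) ->
  (forall i x, box lo hi x -> `|partial i g x| <= N) ->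
  forall u v, box lo hi u -> box lo hi v ->
    `|g u - g v| <= n%:R * N * `|u - v|.
Proof.
move=> N0 dg gN u v bu bv.
(* [p k] takes its first [k] coordinates from [u], so that [p k] and [p k.+1]
   differ in one coordinate and the whole path stays in the box. *)
pose p k : 'rV[R]_n := \row_j (if (j < k)%N then u 0 j else v 0 j).
have bp k : box lo hi (p k).
  by move=> j; rewrite mxE; case: ifP => _; [exact: bu|exact: bv].
have step k : (k <= n)%N -> `|g (p k) - g v| <= k%:R * N * `|u - v|.
  elim: k => [|k IH] kn.
    rewrite (_ : p 0%N = v) ?subrr ?normr0 ?mul0r//.
    by apply/rowP => j; rewrite mxE.
  pose i := Ordinal kn.
  have pS : p k.+1 = (u 0 i - v 0 i) *: delta_mx 0 i + p k.
    apply/rowP => j; rewrite !mxE eqxx /= ltnS leq_eqVlt -(inj_eq val_inj) /=.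
    case: eqVneq => [jk|_] /=; last by rewrite mulr0 add0r.
    by rewrite jk ltnn mulr1 (_ : j = i) ?subrK//; exact: val_inj.
  have seg (t : R) : (0 <= t <= u 0 i - v 0 i) || (u 0 i - v 0 i <= t <= 0) ->
      box lo hi (t *: delta_mx 0 i + p k).
    move=> ht j; rewrite !mxE eqxx /= -(inj_eq val_inj) /=.
    case: eqVneq => [jk|_] /=; last first.
      by rewrite mulr0 add0r; have := bp k j; rewrite mxE.
    rewrite jk ltnn (_ : j = i); last exact: val_inj.
    have /andP[? ?] := bu i; have /andP[? ?] := bv i.
    by rewrite mulr1; case/orP: ht => /andP[? ?]; apply/andP; split; lra.
  have [t ht gE] := mvt_partial (fun t ht => dg i _ (seg t ht)).
  rewrite pS -[X in X - g v](subrK (g (p k))) -addrA gE.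
  apply: le_trans (ler_normD _ _) _; rewrite -natr1 [in leRHS]mulrDl mul1r [in leRHS]mulrDl [leRHS]addrC.
  apply: lerD; last exact/IH/ltnW.
  rewrite normrM mulrC; apply: ler_pM => //; first exact/gN/seg.
  rewrite [leRHS]/Num.norm /= mx_normrE.
  have := @le_bigmax _ _ _ 0 (fun ij : 'I_1 * 'I_n => `|(u - v) ij.1 ij.2|) (0, i).
  by rewrite /= !mxE.
have := step n (leqnn n).
by rewrite (_ : p n = u)//; apply/rowP => j; rewrite mxE ltn_ord.
Qed.
End Calculus.

(** * C^r norms *)

Section Spaces.
Variable R : realType.

Lemma Ck_leq n k k' (U : set 'rV[R]_n) u : (k <= k')%N -> Ck k' U u -> Ck k U u.
Proof.
move=> kk' uk; apply: CkP => [l x lk|l i x lk].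
  exact: (Ck_continuous_partials uk (leq_trans lk kk')).
by move=> Ux; apply: Ck_derivable_partials uk _ Ux; exact: leq_trans lk kk'.
Qed.

Lemma box_dist n (lo hi u v : 'rV[R]_n) :
  box lo hi u -> box lo hi v -> `|u - v| <= `|hi - lo|.
Proof.
move=> bu bv; rewrite [leLHS]/Num.norm /= mx_normrE.
apply: bigmax_le => // -[i j] _ /=; rewrite (ord1 i).
have -> : `|hi - lo| = mx_norm (hi - lo) by [].
rewrite mx_normrE.
apply: le_trans (@le_bigmax _ _ _ 0 (fun ij : 'I_1 * 'I_n => `|(hi - lo) ij.1 ij.2|) (0, j)).
rewrite /= !mxE; have /andP[? ?] := bu j; have /andP[? ?] := bv j.
by rewrite [leRHS]ger0_norm; [rewrite ler_norml; apply/andP; split; lra|lra].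
Qed.

Variables (n : nat) (X : topologicalType) (M : manifold R n X).
Variable D : box_cover M.

(** An integer exponent truncates to [k] itself. Membership makes the extended norm finite, so
    [fine] keeps it an upper bound for the partial derivatives on the boxes. *)
Lemma Cr_natP k B : fs_mem (Cr D k%:R) B ->
  (forall c, Ck k (img (M c)) (B \o bwd (M c))) /\
  (forall i l u, box (blo i) (bhi i) u -> (size l <= k)%N ->
     `|partials l (B \o bwd (M (@bchart _ _ _ _ D i))) u| <= fs_norm (Cr D k%:R) B).
Proof.
move=> [/= Bk Bfin]; rewrite natrK in Bk; split => // i l u bu lk.
have le : (`|partials l (B \o bwd (M (bchart i))) u|%:E <= Cr_enorm D k%:R B)%E.
  by apply: ereal_sup_ubound; left; exists i, l, u; rewrite natrK.
rewrite /=; case: (Cr_enorm _ _ _) le Bfin => // x; rewrite lee_fin.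
Qed.

Lemma Cr_norm_ge0 r B : 0 <= fs_norm (Cr D r) B.
Proof.
rewrite /= /Cr_enorm; set S := (_ `|` _).
have S0 e : S e -> (0 <= e)%E.
  by case=> [[i [l [u [_ _ ->]]]]|[i [l [u [v [_ _ _ _ [_ ->]]]]]]];
    rewrite lee_fin// divr_ge0// powR_ge0.
(* The supremum of the empty set is [-oo], which [fine] sends to 0. *)
have [->|/set0P[e Se]] := eqVneq S set0; first by rewrite ereal_sup0.
by apply: fine_ge0; apply: le_trans (S0 _ Se) (ereal_sup_ubound Se).
Qed.

(** Since [Num.truncn r < k], the derivatives entering the Hoelder seminorm have bounded derivatives
    of one order more. They are thus Lipschitz on each box, hence Hoelder because boxes have bounded
    diameter. *)
Lemma Cr_embedding (r : R) k : (Num.truncn r < k)%N ->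
  exists2 C, 0 < C & forall B N, 0 <= N ->
   (forall c, Ck k (img (M c)) (B \o bwd (M c))) ->
   (forall i l u, box (blo i) (bhi i) u -> (size l <= k)%N ->
      `|partials l (B \o bwd (M (@bchart _ _ _ _ D i))) u| <= N) ->
   fs_mem (Cr D r) B /\ fs_norm (Cr D r) B <= C * N.
Proof.
move=> rk; pose W := \sum_i `|bhi i - @blo _ _ _ _ D i|.
have W0 : 0 <= W by exact: sumr_ge0.
exists (1 + n%:R * (1 + W)).
  by rewrite ltr_wpDr// mulr_ge0// addr_ge0.
move=> B N N0 Bk BN; set C := (1 + _).
have C1 : N <= C * N.
  by rewrite ler_peMl// lerDl mulr_ge0// addr_ge0.
have le : (Cr_enorm D r B <= (C * N)%:E)%E.
  apply: ub_ereal_sup => _ [[i [l [u [bu lk ->]]]]|[i [l [u [v [bu bv uv lk [a0 ->]]]]]]].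
    by rewrite lee_fin; apply: le_trans C1; apply: BN => //; apply: leq_trans lk (ltnW rk).
  rewrite lee_fin; set d := partials l _; set a := r - _ in a0 *.
  have uv0 : 0 < `|u - v| by rewrite normr_gt0 subr_eq0.
  rewrite ler_pdivrMr ?powR_gt0//.
  have lkk : (size l < k)%N by rewrite lk.
  apply: (le_trans (@box_lipschitz R n (blo i) (bhi i) d N N0 _ _ _ _ bu bv)).
  - by move=> j x bx; apply: Ck_derivable_partials (Bk _) lkk _; exact: box_img bx.
  - by move=> j x bx; exact: (BN i (j :: l)).
  have uvW : `|u - v| <= W.
    apply: le_trans (box_dist bu bv) _; rewrite /W (bigD1 i)//= lerDl.
    exact: sumr_ge0.
  have aE : a <= 1.
    by rewrite lerBlDl natr1 ltW// real_truncnS_gt// num_real.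
  (* Up to distance 1 the power with exponent [a <= 1] dominates the distance; beyond it the power
     is at least 1 and the distance at most [W], which bounds all box diameters. *)
  have xW : `|u - v| <= (1 + W) * `|u - v| `^ a.
    have [x1|/ltW x1] := leP `|u - v| 1.
      apply: le_trans (ger1_powR _ aE) _; first by rewrite uv0.
      by rewrite ler_peMl ?powR_ge0// lerDl.
    have : 1 <= `|u - v| `^ a by rewrite -(powRr0 `|u - v|) ler_powR// ltW.
    have := uvW; nra.
  have := ler_wpM2l (mulr_ge0 (ler0n R n) N0) xW.
  have := mulr_ge0 N0 (powR_ge0 `|u - v| a).
  rewrite /C; set y := _ `^ a; set x := `|u - v|; set nn := n%:R; lra.
split; first split.
- by move=> c; apply: Ck_leq (Bk c); exact: ltnW.
- exact: le_lt_trans le (ltry _).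
rewrite /=; case: (Cr_enorm _ _ _) le => [x|//|_] /=; first by rewrite lee_fin.
by rewrite (le_trans N0).
Qed.
End Spaces.

(** * Measurability on products of compact spaces *)

Section Measurability.
Variable R : realType.

Lemma open_borel_measurable (X : ptopologicalType) (A : set X) :
  open A -> measurable (A : set (borel X)).
Proof. by move=> oA; exact: sub_sigma_algebra. Qed.

Lemma continuous_borel_measurable (X : ptopologicalType) (g : X -> R) :
  continuous g -> measurable_fun [set: borel X] (g : borel X -> R).
Proof.
move=> /continuousP gc; apply: (measurability _ (@measurable_realfun.RGenOInfty.measurableE R)).
move=> _ [_ [a ->] <-]; rewrite setTI.
by apply: open_borel_measurable; apply: gc; exact: rray_open.
Qed.

Lemma open_rectangle (X Y : topologicalType) (A : set (X * Y)%type) p :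
  open A -> A p -> exists V W, [/\ open V, open W, V p.1, W p.2 & V `*` W `<=` A].
Proof.
rewrite openE => /[apply] -[[V W] [/= + +] VWA].
rewrite nbhsE => -[V' [oV' V'p] V'V].
rewrite nbhsE => -[W' [oW' W'p] W'W].
exists V', W'; split => // -[x y] [/= /V'V Vx /W'W Wy]; exact: VWA.
Qed.

(* An open superset of a compact set contains a finite union of rectangles
   around it; so [a < g] is a countable union of such finite unions even though
   [X] and [Y] are not assumed second countable. *)
Lemma continuous_prod_measurable (X Y : ptopologicalType) (g : X * Y -> R) :
  compact [set: X] -> compact [set: Y] -> continuous g ->
  measurable_fun [set: (borel X * borel Y)%type] (g : (borel X * borel Y)%type -> R).
Proof.
move=> cX cY gc; apply: (measurability _ (@measurable_realfun.RGenOInfty.measurableE R)).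
move=> _ [_ [a ->] <-]; rewrite setTI.
have oA : open (g @^-1` `]a, +oo[) by move/continuousP: gc; apply; exact: rray_open.
set A := g @^-1` _ in oA *.
(* The superlevel sets at [a + 1/(n+1)] are compact and exhaust [A], so one measurable set between
   each of them and [A] suffices. *)
have rect n : exists B : set (borel X * borel Y)%type, [/\ measurable B, B `<=` A &
    g @^-1` `[a + n.+1%:R^-1, +oo[ `<=` B].
  have cK : compact (g @^-1` `[a + n.+1%:R^-1, +oo[).
    apply: (@subclosed_compact _ _ ([set: X] `*` [set: Y])) => //.
      by apply: preimage_closed; [move=> p _; exact: gc|exact: rray_closed].
    exact: compact_setX.
  have KA : g @^-1` `[a + n.+1%:R^-1, +oo[ `<=` A.
    move=> p; rewrite /A /= !in_itv /= !andbT; apply: lt_le_trans.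
    by rewrite ltrDl.
  pose good (B : set (borel X * borel Y)%type) := measurable B /\ B `<=` A.
  (* The covering form of compactness along the filter of measurable subsets
     of [A] directed by inclusion yields one such subset containing the compact. *)
  pose F := [set Q : set (set (borel X * borel Y)%type) | exists2 B0, good B0 &
    forall B, good B -> B0 `<=` B -> Q B].
  have FF : Filter F.
    split.
    - by exists set0 => //; split; [exact: measurable0|exact: sub0set].
    - move=> Q Q' [B [mB BA] BQ] [B' [mB' BA'] BQ'].
      exists (B `|` B'); first by split; [exact: measurableU|rewrite subUset].
      move=> C gC; rewrite subUset => -[? ?].
      by split; [exact: BQ|exact: BQ'].
    - by move=> Q Q' QQ' [B gB BQ]; exists B => // C gC BC; apply/QQ'/BQ.
  move: cK => /compact_near_coveringP/(_ _ F (fun B p => B p) FF)[p /KA Ap|B0 gB0 B0P].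
    have [V [W [oV oW Vp Wp VWA]]] := open_rectangle oA Ap.
    exists (V `*` W, [set B | good B /\ V `*` W `<=` B]) => /=.
      split.
        exists (V, W) => //.
        by split; apply: open_nbhs_nbhs.
      exists (V `*` W) => //; split => //.
      by apply: measurableX; exact: open_borel_measurable.
    by move=> [p' B] [/= VWp [_]]; apply.
  have [? ?] := gB0; exists B0; split => //.
  exact: B0P.
have [B BP] := choice rect.
rewrite (_ : A = \bigcup_n B n).
  by apply: bigcup_measurable => n _; have [] := BP n.
apply/seteqP; split=> [p|p [n _]]; last by have [_ + _] := BP n; apply.
rewrite /A /= in_itv /= andbT => ap.
have [n np] := ltr_add_invr ap.
exists n => //; have [_ _] := BP n; apply.
by rewrite /= in_itv /= andbT ltW.
Qed.

End Measurability.

(** * Integrals of bounded functions against probability measures *)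

Section Expectations.
Context d (T : measurableType d) (R : realType) (P : probability T R).

Lemma bounded_integrable (g : T -> R) N :
  measurable_fun setT g -> (forall x, `|g x| <= N) ->
  P.-integrable setT (EFin \o g).
Proof.
move=> mg gN; apply: measurable_bounded_integrable => //.
  exact: le_lt_trans (probability_le1 _ _) (ltry _).
by exists N; split; [exact: num_real|move=> M NM x _; exact: le_trans (gN x) (ltW NM)].
Qed.

Lemma Rintegral_probability_cst (a : R) : \int[P]_x a = a.
Proof. rewrite Rintegral_cst// [X in _ * X](_ : _ = 1) ?mulr1//.
exact: (congr1 fine (probability_setT P)). Qed.

Lemma Rintegral_le_cst (g : T -> R) N : P.-integrable setT (EFin \o g) ->
  (forall x, g x <= N) -> \int[P]_x g x <= N.
Proof.
move=> ig gN; rewrite -[leRHS]Rintegral_probability_cst.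
apply: le_Rintegral => //; exact: finite_measure_integrable_cst.
Qed.

Lemma normr_Rintegral_le (g : T -> R) N : P.-integrable setT (EFin \o g) ->
  (forall x, `|g x| <= N) -> `|\int[P]_x g x| <= N.
Proof.
move=> ig gN; apply: le_trans (le_normr_Rintegral _ ig) _ => //.
apply: Rintegral_le_cst => //.
exact: (integrable_norm ig).
Qed.

Lemma normr_RintegralB_le (g h : T -> R) e :
  P.-integrable setT (EFin \o g) -> P.-integrable setT (EFin \o h) ->
  (forall x, `|g x - h x| <= e) -> `|\int[P]_x g x - \int[P]_x h x| <= e.
Proof.
move=> ig ih gh; rewrite -RintegralB//; apply: normr_Rintegral_le => //.
exact: (integrableB measurableT ig ih).
Qed.

End Expectations.

Lemma continuous_bounded (R : realType) (X : topologicalType) (g : X -> R) :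
  compact [set: X] -> continuous g -> exists N, forall x, `|g x| <= N.
Proof.
move=> cX gc.
have /compact_bounded[N [_ NP]] : compact (range g).
  by apply: continuous_compact => //; exact: continuous_subspaceT.
exists (`|N| + 1) => x; apply: NP; last by exists x.
by apply: le_lt_trans (ler_norm N) _; rewrite ltrDl.
Qed.

Lemma continuous_integrable (R : realType) (X : ptopologicalType)
    (P : probability (borel X) R) (g : X -> R) :
  compact [set: X] -> continuous g ->
  P.-integrable setT (EFin \o (g : borel X -> R)).
Proof.
move=> cX gc; have [N gN] := continuous_bounded cX gc.
exact: bounded_integrable (continuous_borel_measurable gc) gN.
Qed.

(** Fubini's theorem; the bound makes every inner integral finite, so that the real inner integral
    agrees with the extended one, [fubini_F]. *)
Lemma Rintegral_prod (R : realType) d d' (X : measurableType d)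
    (Y : measurableType d') (P : probability X R) (Q : probability Y R)
    (g : X * Y -> R) N :
  measurable_fun setT g -> (forall p, `|g p| <= N) ->
  P.-integrable setT (EFin \o (fun x => \int[Q]_y g (x, y))) /\
  \int[(P \x Q)%E]_p g p = \int[P]_x \int[Q]_y g (x, y).
Proof.
move=> mg gN.
have ig : (P \x Q)%E.-integrable setT (EFin \o g).
  exact: (@bounded_integrable _ _ _ (P \x Q)%E g N mg gN).
have E : EFin \o (fun x => \int[Q]_y g (x, y)) = fubini_F Q (EFin \o g).
  apply/funext => x; rewrite /fubini_F /= /Rintegral fineK//.
  apply: integrable_fin_num => //.
  apply: (@bounded_integrable _ _ _ _ (fun y => g (x, y)) N) => //.
  exact: measurableT_comp mg (measurable_pair1 x).
split; first by rewrite E; exact: integrable_fubini_F.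
rewrite /Rintegral -integral12_prod_meas1//; congr fine.
by apply: eq_integral => x _; rewrite -/(fubini_F Q (EFin \o g) x) -E.
Qed.

(** * Slices and differentiation under the integral *)

Section Slices.
Variable R : realType.

Lemma cvg_row_mx (T : Type) (F : set_system T) {FF : Filter F} m n
    (f : T -> 'rV[R]_m) (g : T -> 'rV[R]_n) (a : 'rV[R]_m) (b : 'rV[R]_n) :
  f @ F --> a -> g @ F --> b -> (fun t => row_mx (f t) (g t)) @ F --> row_mx a b.
Proof.
move=> /cvgrPdist_lt fa /cvgrPdist_lt gb; apply/cvgrPdist_lt => e e0.
near=> t; rewrite opp_row_mx add_row_mx [ltLHS]/Num.norm /= mx_normrE.
apply: bigmax_lt => //= -[i j] _ /=; rewrite (ord1 i).
rewrite -(splitK j); case: (fintype.split j) => {}j /=.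
- rewrite row_mxEl; apply: (@le_lt_trans _ _ `|a - f t|); last by near: t; exact: fa.
  rewrite [leRHS]/Num.norm /= mx_normrE.
  exact: (@le_bigmax _ _ _ 0 (fun ij : 'I_1 * 'I_m => `|(a - f t) ij.1 ij.2|) (0, j)).
- rewrite row_mxEr; apply: (@le_lt_trans _ _ `|b - g t|); last by near: t; exact: gb.
  rewrite [leRHS]/Num.norm /= mx_normrE.
  exact: (@le_bigmax _ _ _ 0 (fun ij : 'I_1 * 'I_n => `|(b - g t) ij.1 ij.2|) (0, j)).
Unshelve. all: by end_near. Qed.

Section RowMx.
Variables (m n : nat) (g : 'rV[R]_(m + n) -> R).

Lemma row_mx_shift_l h i (u : 'rV[R]_m) (w : 'rV[R]_n) :
  row_mx (h *: delta_mx 0 i + u) w = h *: delta_mx 0 (lshift n i) + row_mx u w.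
Proof.
apply/rowP => j; rewrite -(splitK j); case: (fintype.split j) => {}j /=.
  by rewrite row_mxEl [RHS]mxE row_mxEl !mxE eqxx /= (inj_eq (@lshift_inj _ _)).
by rewrite row_mxEr [RHS]mxE row_mxEr !mxE eqxx /= eq_rlshift mulr0 add0r.
Qed.

Lemma row_mx_shift_r h i (u : 'rV[R]_m) (w : 'rV[R]_n) :
  row_mx u (h *: delta_mx 0 i + w) = h *: delta_mx 0 (rshift m i) + row_mx u w.
Proof.
apply/rowP => j; rewrite -(splitK j); case: (fintype.split j) => {}j /=.
  by rewrite row_mxEl [RHS]mxE row_mxEl !mxE eqxx /= eq_lrshift mulr0 add0r.
by rewrite row_mxEr [RHS]mxE row_mxEr !mxE eqxx /= (inj_eq (@rshift_inj _ _)).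
Qed.

(** The difference quotients of the slice and of [g] are the same functions, so their limits agree
    whether or not the derivatives exist. *)
Lemma partials_row_mx_l (w : 'rV[R]_n) l (u : 'rV[R]_m) :
  partials l (fun u => g (row_mx u w)) u =
  partials (map (lshift n) l) g (row_mx u w).
Proof.
elim: l u => //= i l IH u; rewrite /partial /derive /=.
under eq_fun do rewrite -!/(partials _ _) !IH row_mx_shift_l.
by [].
Qed.

Lemma partials_row_mx_r (u : 'rV[R]_m) l (w : 'rV[R]_n) :
  partials l (fun w => g (row_mx u w)) w =
  partials (map (@rshift m n) l) g (row_mx u w).
Proof.
elim: l w => //= i l IH w; rewrite /partial /derive /=.
under eq_fun do rewrite -!/(partials _ _) !IH row_mx_shift_r.
by [].
Qed.

Lemma derivable_partials_row_mx_l (w : 'rV[R]_n) l (u : 'rV[R]_m) i :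
  derivable (partials (map (lshift n) l) g) (row_mx u w) (delta_mx 0 (lshift n i)) ->
  derivable (partials l (fun u => g (row_mx u w))) u (delta_mx 0 i).
Proof.
rewrite /derivable.
rewrite (_ : (fun h : R => h^-1 *: (_ (_ + row_mx u w) - _)) =
  (fun h : R => h^-1 *: (partials l (fun u => g (row_mx u w)) (h *: delta_mx 0 i + u)
     - partials l (fun u => g (row_mx u w)) u)))//.
by apply/funext => h; rewrite !partials_row_mx_l row_mx_shift_l.
Qed.

Lemma derivable_partials_row_mx_r (u : 'rV[R]_m) l (w : 'rV[R]_n) i :
  derivable (partials (map (@rshift m n) l) g) (row_mx u w) (delta_mx 0 (rshift m i)) ->
  derivable (partials l (fun w => g (row_mx u w))) w (delta_mx 0 i).
Proof.
rewrite /derivable.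
rewrite (_ : (fun h : R => h^-1 *: (_ (_ + row_mx u w) - _)) =
  (fun h : R => h^-1 *: (partials l (fun w => g (row_mx u w)) (h *: delta_mx 0 i + w)
     - partials l (fun w => g (row_mx u w)) w)))//.
by apply/funext => h; rewrite !partials_row_mx_r row_mx_shift_r.
Qed.

End RowMx.

(** Near each [(x, y)], both values are within [e / 2] of [g (x, y)]; compactness of [Y] makes the
    neighbourhood of [x] independent of [y]. *)
Lemma uniform_continuity_compact (T Y : topologicalType) (g : T * Y -> R) x e :
  compact [set: Y] -> (forall y, {for (x, y), continuous g}) -> 0 < e ->
  \forall x' \near x, forall y, `|g (x, y) - g (x', y)| <= e.
Proof.
move=> cY gc e0.
have near_e y : [set: Y] y -> \forall y' \near y & x' \near nbhs x,
    `|g (x, y') - g (x', y')| <= e.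
  move=> _.
  have e20 : 0 < e / 2 by rewrite divr_gt0.
  have /cvgrPdist_lt/(_ _ e20) := gc y.
  move=> -[[V W] [/= Vx Wy] VW]; exists (W, V) => // -[y' x'] [/= Wy' Vx'].
  have h1 : `|g (x, y) - g (x, y')| < e / 2.
    by apply: (VW (x, y')); split => //=; exact: nbhs_singleton.
  have h2 : `|g (x, y) - g (x', y')| < e / 2 by apply: (VW (x', y')).
  apply: le_trans (ler_distD (g (x, y)) _ _) _; rewrite distrC [e]splitr.
  by apply: lerD; exact: ltW.
have := (compact_near_coveringP [set: Y]).1 cY T (nbhs x)
  (fun x' y => `|g (x, y) - g (x', y)| <= e) (nbhs_filter x) near_e.
by apply: filterS => x' h y; exact: h.
Qed.

Section Averages.
Variables (m : nat) (Y : ptopologicalType) (nu : probability (borel Y) R).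
Hypothesis cY : compact [set: Y].

Lemma continuous_slice (T Z : topologicalType) (h : T -> Y -> Z) u :
  (forall y, {for (u, y), continuous (fun p => h p.1 p.2)}) -> continuous (h u).
Proof.
move=> hc y; apply: (@continuous_comp _ _ _ (fun y => (u, y)) (fun p => h p.1 p.2)).
  by apply: cvg_pair => //=; exact: cvg_cst.
exact: hc.
Qed.

(** By the mean value theorem in each fibre, the difference quotient is the partial derivative at an
    intermediate point depending on [y]. Compactness of [Y] makes it close to the derivative at [u]
    uniformly in [y], and integration keeps the bound. *)
Lemma is_derive_Rintegral (U : set 'rV[R]_m) (h : 'rV[R]_m -> Y -> R) i u :
  open U -> U u ->
  (forall u y, U u -> {for (u, y), continuous (fun p => h p.1 p.2)}) ->
  (forall u y, U u -> {for (u, y), continuous (fun p => partial i (h ^~ p.2) p.1)}) ->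
  (forall u y, U u -> derivable (h ^~ y) u (delta_mx 0 i)) ->
  is_derive u (delta_mx 0 i) (fun u => \int[nu]_y h u y)
    (\int[nu]_y partial i (h ^~ y) u).
Proof.
move=> oU Uu hc dhc dh.
suff H : (fun t : R => t^-1 *: (\int[nu]_y h (t *: delta_mx 0 i + u) y -
    \int[nu]_y h u y)) @ 0^' --> \int[nu]_y partial i (h ^~ y) u.
  by apply: DeriveDef; [apply/cvg_ex; exists (\int[nu]_y partial i (h ^~ y) u)|apply: cvg_lim H].
apply/cvgrPdist_le => e e0.
have unif : \forall u' \near u, U u' /\
    forall y, `|partial i (h ^~ y) u - partial i (h ^~ y) u'| <= e.
  apply: filterI; first exact: open_nbhs_nbhs.
  apply: (uniform_continuity_compact (g := fun p => partial i (h ^~ p.2) p.1)) => // y.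
  exact: dhc.
have [r /= r0 rP] := (nbhs_ballP _ _).1 unif.
have seg (t : R) : `|t| < r -> U (t *: delta_mx 0 i + u) /\
    forall y, `|partial i (h ^~ y) u - partial i (h ^~ y) (t *: delta_mx 0 i + u)| <= e.
  move=> tr; apply: rP; rewrite -ball_normE /= opprD addrCA subrr addr0 normrN.
  apply: le_lt_trans tr; rewrite normrZ ler_piMr//.
  rewrite [leLHS]/Num.norm /= mx_normrE; apply: bigmax_le => // -[a b] _ /=.
  by rewrite mxE; case: (_ && _); rewrite ?normr1 ?normr0.
near=> t.
have t0 : t != 0 by near: t; exact: nbhs_dnbhs_neq.
have tr : `|t| < r.
  near: t; apply: dnbhs0_lt => //.
have Ut := (seg t tr).1.
have ih u' : U u' -> nu.-integrable setT (EFin \o (h u' : borel Y -> R)).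
  by move=> Uu'; apply: continuous_integrable => //; apply: continuous_slice => y; exact: hc.
have idh : nu.-integrable setT (EFin \o (fun y : borel Y => partial i (h ^~ y) u)).
  apply: continuous_integrable => //.
  by apply: (continuous_slice (h := fun u y => partial i (h ^~ y) u)) => y; exact: dhc.
rewrite /GRing.scale /= -RintegralB//; [|exact: ih|exact: ih].
have ihB := integrableB measurableT (ih _ Ut) (ih _ Uu).
rewrite -RintegralZl//.
apply: normr_RintegralB_le => //.
  exact: (integrableZl measurableT _ ihB).
move=> y.
have [s hs ->] : exists2 s : R, `|s| < r &
   h (t *: delta_mx 0 i + u) y - h u y = t * partial i (h ^~ y) (s *: delta_mx 0 i + u).
  have sub s : (0 <= s <= t) || (t <= s <= 0) -> `|s| < r.
    move=> st; apply: le_lt_trans tr.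
    case/orP: st => /andP[? ?]; first by rewrite !ger0_norm//; lra.
    by rewrite !ler0_norm//; lra.
  have [s st E] := @mvt_partial _ _ (h ^~ y) i u t
    (fun s st => dh _ _ (seg s (sub s st)).1).
  by exists s => //; exact: sub.
rewrite mulrA mulVf// mul1r.
exact: (seg s hs).2.
Unshelve. all: by end_near. Qed.

End Averages.
End Slices.

(** * Regularity of averages over a compact fibre and of slices on a product *)

Section SmoothAverages.
Variable R : realType.

Section Average.
Variables (m k : nat) (Y : ptopologicalType) (nu : probability (borel Y) R).
Variables (U : set 'rV[R]_m) (h : 'rV[R]_m -> Y -> R).
Hypothesis cY : compact [set: Y].
Hypothesis oU : open U.
Hypothesis partials_continuous : forall l u y, (size l <= k)%N -> U u ->
  {for (u, y), continuous (fun p => partials l (h ^~ p.2) p.1)}.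
Hypothesis partials_derivable : forall l i u y, (size l < k)%N -> U u ->
  derivable (partials l (h ^~ y)) u (delta_mx 0 i).

Let avg u := \int[nu]_y h u y.

(** Induction step for commuting partial derivatives with the average: the identity for [l] holds on
    the open set [U], hence near [u], and may be differentiated once more. *)
Lemma is_derive_partials_avg l i u :
  (forall u, U u -> partials l avg u = \int[nu]_y partials l (h ^~ y) u) ->
  (size l < k)%N -> U u ->
  is_derive u (delta_mx 0 i) (partials l avg) (\int[nu]_y partials (i :: l) (h ^~ y) u).
Proof.
move=> E lk Uu.
apply: (@near_eq_is_derive _ _ _ (fun u => \int[nu]_y partials l (h ^~ y) u)).
  have : \near u, U u by exact: open_nbhs_nbhs.
  by apply: filterS => u' /E ->.
apply: (@is_derive_Rintegral R m Y nu cY U (fun u y => partials l (h ^~ y) u)) => //.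
- by move=> u' y; apply: partials_continuous; exact: ltnW.
- by move=> u' y; exact: (partials_continuous (l := i :: l)).
- by move=> u' y; exact: partials_derivable.
Qed.

Lemma partials_Rintegral l u : (size l <= k)%N -> U u ->
  partials l avg u = \int[nu]_y partials l (h ^~ y) u.
Proof.
elim: l u => //= i l IH u lk Uu.
have [_ <-] := is_derive_partials_avg i (fun u => IH u (ltnW lk)) lk Uu.
by [].
Qed.

Lemma Ck_Rintegral : Ck k U avg.
Proof.
apply: CkP => [l u lk Uu|l i u lk Uu]; last first.
  have [] // := is_derive_partials_avg i (fun u => @partials_Rintegral l u (ltnW lk)) lk Uu.
have near_avg : {near u, (fun u => \int[nu]_y partials l (h ^~ y) u) =1 partials l avg}.
  have : \near u, U u by exact: open_nbhs_nbhs.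
  by apply: filterS => u' Uu'; rewrite partials_Rintegral.
rewrite /prop_for /continuous_at partials_Rintegral//.
apply: cvg_trans (near_eq_cvg near_avg) _.
apply/cvgrPdist_le => e e0.
have unif := uniform_continuity_compact (g := fun p => partials l (h ^~ p.2) p.1)
  cY (fun y => partials_continuous (l := l) (y := y) lk Uu) e0.
have ih u' : U u' -> nu.-integrable setT (EFin \o (fun y : borel Y => partials l (h ^~ y) u')).
  move=> Uu'; apply: continuous_integrable => //.
  apply: (continuous_slice (h := fun u y => partials l (h ^~ y) u)) => y.
  exact: partials_continuous.
near=> u'.
have Uu' : U u' by near: u'; exact: open_nbhs_nbhs.
apply: normr_RintegralB_le; [exact: ih|exact: ih|].
by near: u'; exact: unif.
Unshelve. all: by end_near. Qed.

End Average.

Section ProductFunction.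
Variables (m n k : nat) (X Y : topologicalType).
Variables (MX : manifold R m X) (MY : manifold R n Y) (B : X * Y -> R).
Hypothesis Bk : forall c, Ck k (img (prod_manifold MX MY c))
  (B \o bwd (prod_manifold MX MY c)).

(** In a chart around [y], a slice is the coordinate expression of [B] with half of the row
    frozen. *)
Lemma slice_l c c' y : dom (MY c') y ->
  (fun u => B (bwd (MX c) u, y)) =
  (fun u => (B \o bwd (prod_manifold MX MY (c, c'))) (row_mx u (fwd (MY c') y))).
Proof. by move=> dy; apply/funext => u; rewrite /= row_mxKl row_mxKr fwdK. Qed.

Lemma slice_r c c' x : dom (MX c) x ->
  (fun w => B (x, bwd (MY c') w)) =
  (fun w => (B \o bwd (prod_manifold MX MY (c, c'))) (row_mx (fwd (MX c) x) w)).
Proof. by move=> dx; apply/funext => w; rewrite /= row_mxKl row_mxKr fwdK. Qed.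

Lemma img_row_mx c c' u y : img (MX c) u -> dom (MY c') y ->
  img (prod_manifold MX MY (c, c')) (row_mx u (fwd (MY c') y)).
Proof. by move=> Uu dy; split; rewrite ?row_mxKl ?row_mxKr//; exact: fwd_img. Qed.

(** Here [y] varies too, so a chart around the limit point is fixed and the coordinate expression is
    used only near that point. *)
Lemma partials_slice_l_continuous c l u y : (size l <= k)%N -> img (MX c) u ->
  {for (u, y), continuous (fun p => partials l (fun u => B (bwd (MX c) u, p.2)) p.1)}.
Proof.
move=> lk Uu; have [c' dy] := atlas_cover MY y.
pose g := B \o bwd (prod_manifold MX MY (c, c')).
have E y' : dom (MY c') y' -> forall u',
    partials l (fun u => B (bwd (MX c) u, y')) u' =
    partials (map (lshift n) l) g (row_mx u' (fwd (MY c') y')).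
  by move=> dy' u'; rewrite (slice_l c dy') partials_row_mx_l.
have near_g : {near (u, y), (fun p => partials (map (lshift n) l) g
     (row_mx p.1 (fwd (MY c') p.2))) =1
   (fun p => partials l (fun u => B (bwd (MX c) u, p.2)) p.1)}.
  exists (setT, dom (MY c')) => /=.
    by split; [exact: filterT|apply: open_nbhs_nbhs; split => //; exact: open_dom].
  by move=> [u' y'] [_ dy']; rewrite E.
rewrite /prop_for /continuous_at /= (E y dy).
apply: cvg_trans (near_eq_cvg near_g) _.
have gc : {for row_mx u (fwd (MY c') y), continuous (partials (map (lshift n) l) g)}.
  by apply: Ck_continuous_partials (Bk _) _ _; [rewrite size_map|exact: img_row_mx].
apply: (@cvg_comp _ _ _ (fun p : 'rV[R]_m * Y => row_mx p.1 (fwd (MY c') p.2)) _ _ _ _ _ gc).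
apply: cvg_row_mx; first exact: cvg_fst.
apply: (@cvg_comp _ _ _ snd (fwd (MY c'))); first exact: cvg_snd.
exact: fwd_continuous.
Qed.

Lemma partials_slice_l_derivable c l i u y : (size l < k)%N -> img (MX c) u ->
  derivable (partials l (fun u => B (bwd (MX c) u, y))) u (delta_mx 0 i).
Proof.
move=> lk Uu; have [c' dy] := atlas_cover MY y.
rewrite (slice_l c dy); apply: derivable_partials_row_mx_l.
by apply: Ck_derivable_partials (Bk _) _ _; [rewrite size_map|exact: img_row_mx].
Qed.

Lemma Ck_slice_r x c' : Ck k (img (MY c')) ((fun y => B (x, y)) \o bwd (MY c')).
Proof.
have [c dx] := atlas_cover MX x.
have gimg w : img (MY c') w ->
    img (prod_manifold MX MY (c, c')) (row_mx (fwd (MX c) x) w).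
  by move=> Ww; split; rewrite ?row_mxKl ?row_mxKr//; exact: fwd_img.
rewrite [X in Ck _ _ X](slice_r c' dx).
apply: CkP => [l w lk Ww|l i w lk Ww].
  rewrite [X in {for _, continuous X}](_ : _ = fun w => partials
     (map (@rshift m n) l) (B \o bwd (prod_manifold MX MY (c, c')))
     (row_mx (fwd (MX c) x) w)).
    have rc : row_mx (fwd (MX c) x) @ w --> row_mx (fwd (MX c) x) w.
      apply: (@cvg_row_mx R _ (nbhs w) (nbhs_filter w) m n (fun=> fwd (MX c) x) id).
        exact: cvg_cst.
      exact: cvg_id.
    apply: continuous_comp rc _.
    by apply: Ck_continuous_partials (Bk _) _ _; [rewrite size_map|exact: gimg].
  by apply/funext => w'; rewrite partials_row_mx_r.
apply: derivable_partials_row_mx_r.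
by apply: Ck_derivable_partials (Bk _) _ _; [rewrite size_map|exact: gimg].
Qed.

Variables (DX : box_cover MX) (DY : box_cover MY) (N : R).
Hypothesis BN : forall i l w,
  box (@blo _ _ _ _ (prod_box_cover DX DY) i) (bhi i) w -> (size l <= k)%N ->
  `|partials l (B \o bwd (prod_manifold MX MY (bchart i))) w| <= N.

(** Every [y] has coordinates in some box of [DY], so the slice derivative is a partial derivative
    of [B] at a point of a product box. *)
Lemma partials_slice_l_le i l u y : box (blo i) (bhi i) u -> (size l <= k)%N ->
  `|partials l (fun u => B (bwd (MX (@bchart _ _ _ _ DX i)) u, y)) u| <= N.
Proof.
move=> bu lk; have [j [w bw <-]] := box_covers DY y.
have dw : dom (MY (bchart j)) (bwd (MY (bchart j)) w).
  exact/bwd_dom/(box_img bw).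
rewrite (slice_l _ dw) partials_row_mx_l bwdK; last exact: box_img bw.
apply: (BN (i := (i, j))); last by rewrite size_map.
by apply/box_row_mx; rewrite row_mxKl row_mxKr.
Qed.

Lemma partials_slice_r_le x j l w : box (blo j) (bhi j) w -> (size l <= k)%N ->
  `|partials l (fun w => B (x, bwd (MY (@bchart _ _ _ _ DY j)) w)) w| <= N.
Proof.
move=> bw lk; have [i [u bu <-]] := box_covers DX x.
have du : dom (MX (bchart i)) (bwd (MX (bchart i)) u).
  exact/bwd_dom/(box_img bu).
rewrite (slice_r _ du) partials_row_mx_r bwdK; last exact: box_img bu.
apply: (BN (i := (i, j))); last by rewrite size_map.
by apply/box_row_mx; rewrite row_mxKl row_mxKr.
Qed.

Lemma normr_le_partials_bound p : `|B p| <= N.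
Proof.
case: p => x y; have [i [u bu <-]] := box_covers DX x.
exact: (@partials_slice_l_le i [::] u y bu).
Qed.

End ProductFunction.

Lemma manifold_continuous n k (X : topologicalType) (M : manifold R n X) (B : X -> R) :
  (forall c, Ck k (img (M c)) (B \o bwd (M c))) -> continuous B.
Proof.
move=> Bk x; have [c dx] := atlas_cover M x.
have near_B : {near x, (B \o bwd (M c)) \o fwd (M c) =1 B}.
  have : \near x, dom (M c) x by apply: open_nbhs_nbhs; split => //; exact: open_dom.
  by apply: filterS => x' dx'; rewrite /= fwdK.
apply: cvg_trans (near_eq_cvg near_B) _.
have : {for x, continuous ((B \o bwd (M c)) \o fwd (M c))}.
  apply: continuous_comp; first exact: fwd_continuous.
  exact: Ck_continuous (Bk c) (fwd_img dx).
by rewrite /prop_for /continuous_at /= fwdK.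
Qed.

End SmoothAverages.

(** * Slices and averages in C^r *)

Section ProductSpaces.
Variable R : realType.
Variables (m n k : nat) (X Y : ptopologicalType).
Variables (MX : manifold R m X) (MY : manifold R n Y).
Variables (DX : box_cover MX) (DY : box_cover MY).
Variables (nu : probability (borel Y) R).
Hypothesis cY : compact [set: Y].
Let CrXY := Cr (prod_box_cover DX DY) k%:R.

Lemma Cr_nat_normr_le B p : fs_mem CrXY B -> `|B p| <= fs_norm CrXY B.
Proof.
move=> /Cr_natP[_ BN].
exact: (@normr_le_partials_bound _ _ _ k _ _ _ _ B DX DY _ BN p).
Qed.

Lemma Cr_nat_norm_ge0 B : fs_mem CrXY B -> 0 <= fs_norm CrXY B.
Proof. by move=> /(Cr_nat_normr_le point); apply: le_trans. Qed.

(** The constant is uniform in [x], because mixing of [G] will be applied to slices over the moving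
    points [f^{t_j} x]. *)
Lemma Cr_slice (r : R) : (Num.truncn r < k)%N -> exists2 C, 0 < C &
  forall B x, fs_mem CrXY B -> fs_mem (Cr DY r) (fun y => B (x, y)) /\
    fs_norm (Cr DY r) (fun y => B (x, y)) <= C * fs_norm CrXY B.
Proof.
move=> rk; have [C C0 CP] := Cr_embedding DY rk.
exists C => // B x BC; have [Bk BN] := Cr_natP BC.
apply: CP; first exact: Cr_nat_norm_ge0.
  exact: (Ck_slice_r Bk).
exact: (partials_slice_r_le BN x).
Qed.

Lemma Cr_average (r : R) : (Num.truncn r < k)%N -> exists2 C, 0 < C &
  forall B, fs_mem CrXY B -> fs_mem (Cr DX r) (fun x => \int[nu]_y B (x, y)) /\
    fs_norm (Cr DX r) (fun x => \int[nu]_y B (x, y)) <= C * fs_norm CrXY B.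
Proof.
move=> rk; have [C C0 CP] := Cr_embedding DX rk.
exists C => // B BC; have [Bk BN] := Cr_natP BC.
have cont c := partials_slice_l_continuous Bk (c := c).
have der c := partials_slice_l_derivable Bk (c := c).
have open_c c := @open_img _ _ _ (MX c).
apply: CP; first exact: Cr_nat_norm_ge0.
  move=> c; apply: (Ck_Rintegral nu cY (open_c c)) => [l u y|l i u y].
    exact: (cont c).
  exact: (der c).
move=> i l u bu lk; have Uu := box_img bu.
rewrite [X in partials l X u](_ : _ = fun u => \int[nu]_y B (bwd (MX (bchart i)) u, y))//.
rewrite (partials_Rintegral nu cY (open_c _) (cont _) (der _) lk Uu).
apply: normr_Rintegral_le; last first.
  by move=> y; exact: (partials_slice_l_le BN y bu lk).
apply: continuous_integrable => //.
apply: (continuous_slice (h := fun u y => partials l (fun u => B (bwd (MX (bchart i)) u, y)) u)) => y.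
exact: cont.
Qed.

End ProductSpaces.

(** * Integrals of functions that are small off finitely many exceptional sets *)

Section BadSet.
Context d (T : measurableType d) (R : realType) (P : probability T R).

Lemma measure_bigsetU_le (I : Type) (r : seq I) (Q : pred I) (E : I -> set T) (p : R) :
  0 <= p ->
  (forall i, Q i -> measurable (E i)) -> (forall i, Q i -> (P (E i) <= p%:E)%E) ->
  measurable (\big[setU/set0]_(i <- r | Q i) E i) /\
  (P (\big[setU/set0]_(i <- r | Q i) E i) <= ((size r)%:R * p)%:E)%E.
Proof.
move=> p0 mE PE; elim: r => [|i r [mU PU]].
  by rewrite big_nil measure0 mul0r; split.
have psize : ((size r)%:R * p <= (size (i :: r))%:R * p).
  by rewrite ler_wpM2r// ler_nat.
rewrite big_cons; case: ifP => Qi; last first.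
  by split => //; apply: le_trans PU _; rewrite lee_fin.
split; first by apply: measurableU => //; exact: mE.
apply: le_trans (measureU2 _ (mE i Qi) mU) _.
rewrite [(size _)%:R]mulrS mulrDl mul1r EFinD; apply: leeD => //; exact: PE.
Qed.

(** Integrate [|g| <= a + M * 1_U], where [U] is the union of the exceptional sets, and apply the
    union bound. *)
Lemma normr_Rintegral_le_off (I : finType) (Q : pred I) (E : I -> set T)
    (g : T -> R) (a M p : R) :
  0 <= p -> 0 <= a ->
  (forall i, Q i -> measurable (E i)) -> (forall i, Q i -> (P (E i) <= p%:E)%E) ->
  P.-integrable setT (EFin \o g) ->
  (forall x, `|g x| <= M) ->
  (forall x, (forall i, Q i -> ~ E i x) -> `|g x| <= a) ->
  `|\int[P]_x g x| <= a + M * (#|I|%:R * p).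
Proof.
move=> p0 a0 mE PE ig gM ga.
have M0 : 0 <= M by apply: le_trans (gM point).
have [mU PU] := measure_bigsetU_le (index_enum I) p0 mE PE.
set U := \big[setU/set0]_(i <- index_enum I | Q i) E i in mU PU.
have gU x : `|g x| <= a + M * \1_U x.
  rewrite indicE; have [Ux|nUx] := pselect (U x).
    by rewrite mem_set// mulr1 (le_trans (gM x))// lerDr.
  rewrite memNset// mulr0 addr0; apply: ga => i Qi Ex; apply: nUx.
  by rewrite /U (bigD1 i) //=; left.
have iU : P.-integrable setT (EFin \o (\1_U : T -> R)).
  apply: (@bounded_integrable _ _ _ P _ 1) => [|x].
    exact: measurable_indic.
  by rewrite indicE; case: (_ \in _); rewrite ?normr1 ?normr0.
have iMU : P.-integrable setT (EFin \o (fun x => M * \1_U x)).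
  exact: (integrableZl measurableT M iU).
apply: le_trans (le_normr_Rintegral _ ig) _ => //.
apply: (@le_trans _ _ (\int[P]_x (a + M * \1_U x))).
  apply: le_Rintegral => //.
    exact: (integrable_norm ig).
  exact: (integrableD measurableT (finite_measure_integrable_cst _ a measurableT) iMU).
rewrite RintegralD//; last exact: finite_measure_integrable_cst.
rewrite Rintegral_probability_cst lerD2l RintegralZl// ler_wpM2l//.
rewrite /Rintegral integral_indic// setIT -lee_fin fineK.
  by apply: le_trans PU _; rewrite cardE enumT.
exact: fin_num_measure.
Qed.

End BadSet.

Lemma continuous_prod_seq (R : realType) (X : topologicalType) (I : Type) (r : seq I)
    (g : I -> X -> R) :
  (forall i, continuous (g i)) -> continuous (fun x => \prod_(i <- r) g i x).
Proof.
move=> gc; elim: r => [|i r IH].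
  under eq_fun do rewrite big_nil; exact: cst_continuous.
under eq_fun do rewrite big_cons.
by move=> x; apply: cvgM; [exact: gc|exact: IH].
Qed.

Lemma normr_prod_le (R : realType) (I : finType) (a b : I -> R) :
  (forall i, `|a i| <= b i) -> `|\prod_i a i| <= \prod_i b i.
Proof.
by move=> ab; rewrite normr_prod; apply: ler_prod => i _; rewrite normr_ge0 ab.
Qed.

Section MinGap.
Variables (R : realType) (Theta : Type) (dist : Theta -> Theta -> R) (s : nat).
Variable t : 'I_s -> Theta.

Lemma min_gap_le i j : (forall x y, 0 <= dist x y) -> i != j ->
  min_gap dist t <= dist (t i) (t j).
Proof.
move=> d0 ij; apply: ge_inf; last by exists i, j.
by exists 0 => _ [i' [j' [_ ->]]].
Qed.

(** Two distinct indices make the set of gaps nonempty; otherwise [inf] would take its default value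
    0. *)
Lemma le_min_gap a : (2 <= s)%N ->
  (forall i j, i != j -> a <= dist (t i) (t j)) -> a <= min_gap dist t.
Proof.
move=> s2 ad; apply: lb_le_inf; last by move=> _ [i [j [ij ->]]]; exact: ad.
have s0 := ltnW s2.
by exists (dist (t (Ordinal s0)) (t (Ordinal s2))), (Ordinal s0), (Ordinal s2).
Qed.
End MinGap.

(** * Iterates of the skew product and the cocycle of ergodic sums *)

Section Cocycles.
Variables (R : realType) (X : ptopologicalType) (q : nat).
Variables (f : X -> X) (tau : X -> 'rV[R]_q).
Local Notation esum := (@ergodic_sum R _ (borel X) f q tau).

Lemma ergodic_sumD a b x : esum (a + b) x =
  esum a x + esum b (iter a f x).
Proof.
rewrite /ergodic_sum big_split_ord /=; congr (_ + _).
by apply: eq_bigr => i _; rewrite -iterD addnC.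
Qed.

Lemma iter_skew_product (Y : Type) (G : 'rV[R]_q -> Y -> Y) k x y :
  is_flow G ->
  iter k (skew_product f G tau) (x, y) = (iter k f x, G (esum k x) y).
Proof.
move=> [G0 GD]; elim: k => [|k IH]; first by rewrite /ergodic_sum big_ord0 G0.
by rewrite iterS IH /skew_product /= -GD /ergodic_sum big_ord_recr /= addrC.
Qed.

Lemma iter_continuous (Z : topologicalType) (g : Z -> Z) k :
  continuous g -> continuous (iter k g).
Proof.
move=> gc; elim: k => [|k IH] x; first exact: cvg_id.
by apply: (@continuous_comp _ _ _ (iter k g) g); [exact: IH|exact: gc].
Qed.

Hypothesis f_continuous : continuous f.
Hypothesis tau_continuous : continuous tau.

Lemma ergodic_sum_continuous k : continuous (esum k).
Proof.
elim: k => [|k IH]; rewrite /ergodic_sum.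
  by under eq_fun do rewrite big_ord0; exact: cst_continuous.
under eq_fun do rewrite big_ord_recr.
move=> x; apply: cvgD; first exact: IH.
apply: (@continuous_comp _ _ _ (iter k f) tau); last exact: tau_continuous.
exact: iter_continuous.
Qed.

(** Invariance applies to measurable sets; closedness survives preimages under the continuous
    iterates and so supplies measurability at each step. *)
Lemma preserves_iter (P : probability (borel X) R) k (A : set X) :
  preserves P f -> closed A -> P (iter k f @^-1` A) = P A.
Proof.
move=> fP cA; elim: k => [|k IH]; first by [].
rewrite (_ : _ @^-1` _ = f @^-1` (iter k f @^-1` A)); last first.
  by apply/funext => x; rewrite /preimage /= -iterSr.
rewrite fP ?IH//; rewrite -[_ @^-1` _]setCK; apply: measurableC.
apply: open_borel_measurable; apply: closed_openC.
by apply: preimage_closed => // x _; exact: iter_continuous.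
Qed.

End Cocycles.

(** * Large deviations of the ergodic sums *)

Section LargeDeviations.
Variables (R : realType) (X : ptopologicalType) (q : nat).
Variables (f : X -> X) (tau : X -> 'rV[R]_q) (mu : probability (borel X) R).
Local Notation esum := (@ergodic_sum R _ (borel X) f q tau).
Hypothesis f_continuous : continuous f.
Hypothesis tau_continuous : continuous tau.
Hypothesis f_mu : preserves mu f.

(** The sum starts at [f^a x] because differences of ergodic sums at two times are sums over such a
    block. *)
Definition deviation_set (V : 'rV[R]_q) (e : R) (a k : nat) : set (borel X) :=
  [set x : X | e <= `|k%:R^-1 *: esum k (iter a f x) - V|].

Lemma deviation_set_closed V e k :
  closed ([set x : X | e <= `|k%:R^-1 *: esum k x - V|]).
Proof.
rewrite (_ : [set _ | _] = (fun x : X => `|k%:R^-1 *: esum k x - V|) @^-1` `[e, +oo[); last first.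
  by apply/funext => x; rewrite /preimage /= in_itv /= andbT.
apply: preimage_closed; last exact: rray_closed.
move=> x _; apply: cvg_norm; apply: cvgB; last exact: cvg_cst.
apply: cvgZr; exact: ergodic_sum_continuous.
Qed.

Lemma measurable_deviation_set V e a k : measurable (deviation_set V e a k).
Proof.
rewrite -[deviation_set _ _ _ _]setCK; apply: measurableC.
apply: open_borel_measurable; apply: closed_openC.
apply: (@preimage_closed _ _ (iter a f) [set x : X | e <= `|k%:R^-1 *: esum k x - V|]).
  by move=> x _; exact: iter_continuous.
exact: deviation_set_closed.
Qed.

(** Invariance of [mu] removes the shift by [a], so the bound is uniform in it. *)
Lemma deviation_set_le e : exp_large_deviations mu f tau -> 0 < e ->
  exists C delta, [/\ 0 < C, 0 < delta & forall a k,
    (mu (deviation_set (mean mu tau) e a k) <= (C * expR (- delta * k%:R))%:E)%E].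
Proof.
move=> ld e0; have [C [delta [d0 ldP]]] := ld e e0.
(* A constant at least 1 also covers [k = 0], which occurs when two of the times coincide and where
   only the bound 1 on probabilities is available. *)
exists (`|C| + 1), delta; split => //.
move=> a k.
have -> : mu (deviation_set (mean mu tau) e a k) =
    mu [set x | e <= `|k%:R^-1 *: esum k x - mean mu tau|].
  by rewrite -(preserves_iter f_continuous a f_mu (@deviation_set_closed _ e k)).
case: k => [|k].
  apply: le_trans (probability_le1 _ _) _.
    rewrite -[[set _ | _]]setCK; apply: measurableC.
    apply: open_borel_measurable; apply: closed_openC; exact: deviation_set_closed.
  by rewrite mulr0 expR0 mulr1 lee_fin lerDr.
apply: le_trans (ldP k.+1 isT) _.
by rewrite lee_fin ler_wpM2r ?expR_ge0// (le_trans (ler_norm C))// lerDl.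
Qed.

(** Off the deviation set the time average is within [|V| / 2] of [V], so its norm is at least
    [|V| / 2]. *)
Lemma norm_ergodic_sum_ge V a k x : ~ deviation_set V (`|V| / 2) a k x ->
  k%:R * (`|V| / 2) <= `|esum k (iter a f x)|.
Proof.
move=> /negP; rewrite -ltNge; set S := esum _ _ => h.
case: k S h => [|k] S h; first by rewrite mul0r.
have : `|V| / 2 <= `|k.+1%:R^-1 *: S|.
  have := ler_distD (k.+1%:R^-1 *: S) V 0; rewrite !subr0 distrC; lra.
by rewrite normrZ ger0_norm ?invr_ge0// ler_pdivlMl.
Qed.

(** By the cocycle identity, the difference of two sums is the sum over the block between the two
    times. Pairs are ordered by time so that natural subtraction gives the block length. *)
Lemma ergodic_sum_gap V x s (t : 'I_s -> nat) : (2 <= s)%N ->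
  (forall ij : 'I_s * 'I_s, (ij.1 != ij.2) && (t ij.1 <= t ij.2)%N ->
     ~ deviation_set V (`|V| / 2) (t ij.1) (t ij.2 - t ij.1) x) ->
  `|V| / 2 * min_gap (fun k l : nat => `|k%:R - l%:R| : R) t <=
  min_gap (fun v v' : 'rV[R]_q => `|v - v'|) (fun j => esum (t j) x).
Proof.
move=> s2 good; apply: le_min_gap => // i j ij.
wlog le_ij : i j ij / (t i <= t j)%N.
  move=> H; case/orP: (leq_total (t i) (t j)) => h; first exact: H.
  by rewrite distrC; apply: H => //; rewrite eq_sym.
have := norm_ergodic_sum_ge (good (i, j) _); rewrite /= ij le_ij => /(_ isT).
have -> : esum (t j - t i) (iter (t i) f x) = esum (t j) x - esum (t i) x.
  by rewrite -{2}(subnKC le_ij) ergodic_sumD addrAC subrr add0r.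
rewrite [X in _ <= X]distrC; apply: le_trans; rewrite mulrC ler_wpM2r//.
rewrite natrB// -[leRHS]ger0_norm ?subr_ge0 ?ler_nat// distrC.
exact: (min_gap_le (dist := fun k l : nat => `|k%:R - l%:R| : R)).
Qed.

End LargeDeviations.

(** * Combination of the estimates on the base and in the fibres *)

Lemma prod_le_exprM (R : realType) s (C : R) (N M : 'I_s -> R) :
  (forall j, 0 <= N j) -> (forall j, N j <= C * M j) ->
  \prod_j N j <= C ^+ s * \prod_j M j.
Proof.
move=> N0 NM; rewrite -[in C ^+ s](card_ord s) -prodr_const -big_split /=.
by apply: ler_prod => j _; rewrite N0 NM.
Qed.

(** The constant in [mixing] has no prescribed sign, hence [|C|]; each of the [s] changes of norm
    costs a factor [K]. *)
Lemma mixing_bound (R : realType) s (C K psi : R) (N M : 'I_s -> R) :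
  0 <= psi -> (forall j, 0 <= N j) -> (forall j, N j <= K * M j) ->
  C * psi * \prod_j N j <= `|C| * K ^+ s * psi * \prod_j M j.
Proof.
move=> psi0 N0 NM.
have NK := prod_le_exprM N0 NM.
have P0 : 0 <= \prod_j N j by exact: prodr_ge0.
apply: (@le_trans _ _ (`|C| * psi * \prod_j N j)).
  by rewrite ler_wpM2r// ler_wpM2r// ler_norm.
by rewrite (mulrAC _ (K ^+ s)) -[leRHS]mulrA ler_wpM2l// mulr_ge0.
Qed.

Theorem theorem4p15 (R : realType) (m n q s : nat) (X Y : ptopologicalType)
  (MX : manifold R m X) (MY : manifold R n Y)
  (hausdorffX : hausdorff_space X) (hausdorffY : hausdorff_space Y)
  (compactX : compact [set: X]) (compactY : compact [set: Y])
  (DX : box_cover MX) (DY : box_cover MY)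
  (mu : probability (borel X) R) (nu : probability (borel Y) R)
  (f : X -> X) (G : 'rV[R]_q -> Y -> Y) (tau : X -> 'rV[R]_q)
  (smooth_f : smooth_map MX MX f)
  (f_mu : preserves mu f)
  (smooth_G : smooth_map (prod_manifold (euclidean R q) MY) MY
                (fun p => G p.1 p.2))
  (flow_G : is_flow G)
  (G_nu : forall t, preserves nu (G t))
  (smooth_tau : smooth_map MX (euclidean R q) tau)
  (s_ge2 : (2 <= s)%N)
  (drift : mean mu tau <> 0)
  (large_dev : exp_large_deviations mu f tau)
  (mix_f : exp_mixing_map mu f s (Cr DX))
  (mix_G : exp_mixing_flow nu G s (Cr DY)) :
  exp_mixing_map (mu \x nu)%E (skew_product f G tau) s (Cr (prod_box_cover DX DY)).
Proof.
have fc : continuous f := smooth_f.1.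
have Gc : continuous (fun p : 'rV[R]_q * Y => G p.1 p.2) := smooth_G.1.
have tc : continuous tau := smooth_tau.1.
have Fc : continuous (skew_product f G tau).
  have f1c : continuous (fun p : X * Y => f p.1).
    by move=> p; apply: (@continuous_comp _ _ _ fst f); [exact: cvg_fst|exact: fc].
  have t1c : continuous (fun p : X * Y => tau p.1).
    by move=> p; apply: (@continuous_comp _ _ _ fst tau); [exact: cvg_fst|exact: tc].
  have tyc p : {for p, continuous (fun p : X * Y => (tau p.1, p.2))}.
    exact: (cvg_pair (t1c p) (@cvg_snd _ _ _ _ _)).
  move=> p; apply: (cvg_pair (f1c p)).
  exact: (@continuous_comp _ _ _ _ (fun p => G p.1 p.2) _ (tyc p) (Gc _)).
have [r1 [c1 [r10 c10 [C1 C1P]]]] := mix_f.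
have [r2 [c2 [r20 c20 [C2 C2P]]]] := mix_G.
pose V := mean mu tau; pose e := `|V| / 2.
have e0 : 0 < e by rewrite divr_gt0// normr_gt0; exact/eqP.
have [K3 [delta [K30 delta0 badP]]] := deviation_set_le fc tc f_mu large_dev e0.
pose k := (maxn (Num.truncn r1) (Num.truncn r2)).+1.
have k1 : (Num.truncn r1 < k)%N by rewrite ltnS leq_maxl.
have k2 : (Num.truncn r2 < k)%N by rewrite ltnS leq_maxr.
have [a1 a10 a1P] := Cr_average DX DY nu compactY k1.
have [a2 a20 a2P] := Cr_slice DX DY k2.
pose K1 := `|C1| * a1 ^+ s; pose K2 := `|C2| * a2 ^+ s.
(* The three rates: mixing of [f], large deviations, and mixing of [G], where gaps between the
   ergodic sums are at least [e] times gaps between the times. *)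
pose c := Num.min c1 (Num.min delta (c2 * e)).
have c0 : 0 < c by rewrite !lt_min c10 delta0 mulr_gt0.
(* [K1] and [K2] come from mixing of [f] and of [G]. The last term is the trivial bound 2 on the bad
   set, times the number of pairs in the union bound, times the large deviation constant. *)
exists k%:R, c; split => //; exists (K1 + (K2 + 2 * ((#|{: 'I_s * 'I_s}|)%:R * K3))).
move=> B t BC.
pose N j := fs_norm (Cr (prod_box_cover DX DY) k%:R) (B j).
have N0 j : 0 <= N j by exact: Cr_nat_norm_ge0.
have BN j p : `|B j p| <= N j by exact: Cr_nat_normr_le.
have Bc j : continuous (B j) by exact: manifold_continuous (Cr_natP (BC j)).1.
have Bs j x : continuous (fun y => B j (x, y)).
  move=> y; apply: (@continuous_comp _ _ _ (fun y => (x, y)) (B j)); last exact: Bc.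
  by apply: cvg_pair => //=; exact: cvg_cst.
pose S j := @ergodic_sum R _ (borel X) f q tau (t j).
pose b j x := \int[nu]_y B j (x, y).
(* [H] is the fibre integral of the whole product; [L] is what it becomes if the factors decorrelate
   in the fibre. *)
pose H x := \int[nu]_y \prod_j B j (iter (t j) f x, G (S j x) y).
pose L x := \prod_j b j (iter (t j) f x).
set D := min_gap _ t.
have D0 : 0 <= D by apply: le_min_gap.
have N0' : 0 <= \prod_j N j by exact: prodr_ge0.
have bN j x : `|b j x| <= N j.
  apply: normr_Rintegral_le => [|y]; last exact: BN.
  by apply: continuous_integrable => //; exact: Bs.
have bc j : continuous (b j).
  have [[bk _] _] := a1P _ (BC j).
  exact: manifold_continuous bk.
have [iH HE] : mu.-integrable setT (EFin \o (H : borel X -> R)) /\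
    \int[(mu \x nu)%E]_p \prod_j B j (iter (t j) (skew_product f G tau) p) =
    \int[mu]_x H x.
  have -> : H = fun x => \int[nu]_y \prod_j B j (iter (t j) (skew_product f G tau) (x, y)).
    apply/funext => x; apply: eq_Rintegral => y _.
    by apply: eq_bigr => j _; rewrite iter_skew_product.
  apply: (@Rintegral_prod _ _ _ _ _ mu nu _ (\prod_j N j)).
    apply: continuous_prod_measurable => //; apply: continuous_prod_seq => j p.
    apply: (@continuous_comp _ _ _ (iter (t j) (skew_product f G tau)) (B j)); last exact: Bc.
    exact: iter_continuous.
  by move=> p; apply: normr_prod_le => j; exact: BN.
have LE : \prod_j (\int[(mu \x nu)%E]_p B j p) = \prod_j \int[mu]_x b j x.
  apply: eq_bigr => j _.
  have [] // := @Rintegral_prod _ _ _ _ _ mu nu (B j) (N j).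
  exact: continuous_prod_measurable.
have iL : mu.-integrable setT (EFin \o (L : borel X -> R)).
  apply: continuous_integrable => //; apply: continuous_prod_seq => j x.
  apply: (@continuous_comp _ _ _ (iter (t j) f) (b j)); last exact: bc.
  exact: iter_continuous.
have mixL : `|\int[mu]_x L x - \prod_j \int[mu]_x b j x| <=
    K1 * expR (- c1 * D) * \prod_j N j.
  apply: le_trans (C1P b t (fun j => (a1P _ (BC j)).1)) _.
  apply: mixing_bound => [|j|j]; [exact: expR_ge0|exact: Cr_norm_ge0|exact: (a1P _ (BC j)).2].
have mixH : `|\int[mu]_x (H x - L x)| <=
    K2 * expR (- (c2 * e) * D) * \prod_j N j +
    2 * \prod_j N j * (#|{: 'I_s * 'I_s}|%:R * (K3 * expR (- delta * D))).
  have HN x : `|H x| <= \prod_j N j.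
    apply: normr_Rintegral_le => [|y]; last first.
      by apply: normr_prod_le => j; exact: BN.
    apply: continuous_integrable => //; apply: continuous_prod_seq => j y.
    apply: (@continuous_comp _ _ _ (G (S j x)) (fun y => B j (iter (t j) f x, y))).
      by apply: (continuous_slice (h := G)) => y'; exact: Gc.
    exact: Bs.
  have LN x : `|L x| <= \prod_j N j by apply: normr_prod_le => j; exact: bN.
  apply: (@normr_Rintegral_le_off _ _ _ mu _
    (fun ij => (ij.1 != ij.2) && (t ij.1 <= t ij.2)%N)
    (fun ij => deviation_set f tau V e (t ij.1) (t ij.2 - t ij.1))).
  - by rewrite mulr_ge0 ?expR_ge0// ltW.
  - by rewrite !mulr_ge0 ?expR_ge0// exprn_ge0// ltW.
  - by move=> ij _; exact: measurable_deviation_set.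
  (* Each block has length [t j - t i >= D], so all bad sets share one exponential bound in [D]. *)
  - move=> [i j] /= /andP[ij tij]; apply: le_trans (badP _ _) _.
    rewrite lee_fin ler_wpM2l ?(ltW K30)// ler_expR !mulNr lerN2 ler_wpM2l ?(ltW delta0)//.
    rewrite natrB// -[leRHS]ger0_norm ?subr_ge0 ?ler_nat// distrC.
    exact: (min_gap_le (dist := fun k l : nat => `|k%:R - l%:R| : R)).
  - exact: (integrableB measurableT iH iL).
  - move=> x; apply: le_trans (ler_normB _ _) _.
    by rewrite mulr2n mulrDl mul1r lerD.
  - move=> x good.
    (* Off the bad sets, mixing of [G] at the times [S j x] applies to the slices over [f^{t_j} x],
       and [gap] turns its rate [c2] into [c2 * e] in terms of [D]. *)
    have gap := ergodic_sum_gap s_ge2 good.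
    have := C2P (fun j y => B j (iter (t j) f x, y)) (fun j => S j x)
      (fun j => (a2P _ _ (BC j)).1).
    move=> /le_trans; apply.
    apply: le_trans (mixing_bound C2 (expR_ge0 _) _ _) _.
    + by move=> j; exact: Cr_norm_ge0.
    + by move=> j; exact: (a2P _ _ (BC j)).2.
    rewrite -/K2 ler_wpM2r// ler_wpM2l//.
      by rewrite mulr_ge0// exprn_ge0// ltW.
    by rewrite ler_expR !mulNr lerN2 -mulrA ler_wpM2l// ltW.
have K10 : 0 <= K1 by rewrite mulr_ge0// exprn_ge0// ltW.
have K20 : 0 <= K2 by rewrite mulr_ge0// exprn_ge0// ltW.
rewrite HE LE.
have -> : \int[mu]_x H x - \prod_j \int[mu]_x b j x =
    \int[mu]_x (H x - L x) + (\int[mu]_x L x - \prod_j \int[mu]_x b j x).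
  by rewrite RintegralB//; ring.
apply: le_trans (ler_normD _ _) _.
apply: le_trans (lerD mixH mixL) _.
(* As [D >= 0], all three exponentials are at most the one with the smallest rate [c]. *)
have rate c' : c <= c' -> expR (- c' * D) <= expR (- c * D).
  by move=> cc'; rewrite ler_expR !mulNr lerN2 ler_wpM2r.
have cE : [/\ c <= c1, c <= c2 * e & c <= delta].
  by rewrite /c !ge_min !lexx !orbT.
have [/rate e1 /rate e2 /rate e3] := cE.
have := ler_wpM2l (mulr_ge0 N0' K10) e1.
have := ler_wpM2l (mulr_ge0 N0' K20) e2.
have := ler_wpM2l (mulr_ge0 N0' (mulr_ge0 (ler0n R #|{: 'I_s * 'I_s}|) (ltW K30))) e3.
rewrite -/N; set P := \prod_j _; set n2 := _%:R; lra.
Qed.
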